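(* Let $2\le l\le n-2$ and $n\ge 5$ be integers. The Plücker embedding of the Grassmannian $\operatorname{Gr}(l,n)\subset\mathbb{P}^{\binom{n}{l}-1}$ fails property $\mathbf{N}_3$.
   Context: $k$ is an algebraically closed field; $\operatorname{Gr}(l,n)$ is the Grassmannian of $l$-dimensional subspaces of $k^n$. For $p\ge1$, a nondegenerate closed subscheme $X\subset\mathbb{P}^N=\operatorname{Proj}S$, $S=k[x_0,\dots,x_N]$, with saturated homogeneous ideal $I_X$, satisfies $\mathbf{N}_{2,p}$ if $\operatorname{Tor}_i^S(I_X,k)$ is concentrated in degrees $\le i+2$ for all $0\le i\le p-1$ (i.e. $I_X$ is generated by quadrics and its minimal free resolution is linear for the first $p$ steps). $X$ satisfies property $\mathbf{N}_p$ (of Green and Lazarsfeld) if it is projectively normal (property $\mathbf{N}_0$) and satisfies $\mathbf{N}_{2,p}$. *)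

(* Defs.v *)
From HB Require Import structures.
From mathcomp Require Import all_boot all_order all_fingroup all_algebra.
From mathcomp Require Import mpoly.

Set Implicit Arguments.
Unset Strict Implicit.
Unset Printing Implicit Defensive.

Import Order.TTheory GRing.Theory Num.Theory.
Local Open Scope ring_scope.

(* Throughout, S = {mpoly k[m]} is the homogeneous coordinate ring of
   P^(m - 1), and a point of P^(m - 1) is given by a nonzero vector
   x : 'I_m -> k of homogeneous coordinates. *)

(* A closed subscheme of P^(m - 1) is encoded by its saturated homogeneous
   ideal; saturation is stated as (I : (x_0, ..., x_(m - 1))) = I. *)
Record nondegenerate_subscheme (k : fieldType) (m : nat) := NondegSubscheme {
  in_ideal :> {mpoly k[m]} -> Prop;
  in_ideal0 : in_ideal 0;
  in_idealD : forall f g, in_ideal f -> in_ideal g -> in_ideal (f + g);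
  in_idealM : forall h f, in_ideal f -> in_ideal (h * f);
  ideal_homog : forall d f, in_ideal f -> in_ideal (pihomog mdeg d f);
  ideal_saturated : forall f, (forall i, in_ideal ('X_i * f)) -> in_ideal f;
  ideal_nondegenerate :
    forall f, f \is 1.-homog -> in_ideal f -> f = 0
}.

(* A resolution ... -> F_2 -> F_1 -> F_0 -> I -> 0 by finitely generated graded
   free modules F_i = \bigoplus_c S(- gdeg i c). Elements of F_i are row vectors
   and the maps act by right multiplication. A nonzero entry in row a and column
   b must be homogeneous of degree (degree of generator a) - (degree of
   generator b), so that all maps preserve degree. *)
Record graded_free_resolution (k : fieldType) (m : nat)
    (I : {mpoly k[m]} -> Prop) := GradedFreeResolution {
  grank : nat -> nat;
  gdeg : forall i, 'I_(grank i) -> int;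
  gaug : 'cV[{mpoly k[m]}]_(grank 0);
  gdiff : forall i, 'M[{mpoly k[m]}]_(grank i.+1, grank i);
  gaug_homog : forall a (mu : 'X_{1..m}), mu \in msupp (gaug a 0) ->
    (mdeg mu)%:Z = gdeg a;
  gdiff_homog : forall i a b (mu : 'X_{1..m}), mu \in msupp (gdiff i a b) ->
    (mdeg mu)%:Z = gdeg a - gdeg b;
  gaug_image : forall f, I f <-> exists u : 'rV_(grank 0), u *m gaug = f%:M;
  gexact0 : forall u : 'rV_(grank 0),
    u *m gaug = 0 <-> exists w, u = w *m gdiff 0;
  gexactS : forall i (u : 'rV_(grank i.+1)),
    u *m gdiff i = 0 <-> exists w, u = w *m gdiff i.+1
}.

Section Tor.
Variables (k : fieldType) (m : nat) (I : {mpoly k[m]} -> Prop).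
Variable F : graded_free_resolution I.

(* The differential of F (x)_S k, where k = S / (x_0, ..., x_(m - 1)). *)
Definition tor_diff i : 'M[k]_(grank F i.+1, grank F i) :=
  map_mx (mcoeff 0%MM) (gdiff F i).

Definition tor_cycle i : 'rV[k]_(grank F i) -> Prop :=
  match i with
  | 0 => fun _ => True
  | i'.+1 => fun v => v *m tor_diff i' = 0
  end.

Definition in_tor_degree i (j : int) (v : 'rV[k]_(grank F i)) : Prop :=
  forall c, v 0 c != 0 -> gdeg c = j.

(* H_i(F (x)_S k)_j = 0 *)
Definition tor_homology_eq0 i (j : int) : Prop :=
  forall v : 'rV[k]_(grank F i), in_tor_degree j v -> tor_cycle v ->
  exists2 w, in_tor_degree j w & w *m tor_diff i = v.

End Tor.

(* Tor_i^S(I, k)_j = 0 for all j > c. Such a resolution exists because S is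
   Noetherian, and the homology does not depend on the one chosen. *)
Definition tor_concentrated_le (k : fieldType) (m : nat)
    (I : {mpoly k[m]} -> Prop) (i : nat) (c : int) : Prop :=
  exists F : graded_free_resolution I,
    forall j : int, c < j -> tor_homology_eq0 F i j.

Definition satisfies_N2 (k : fieldType) (m : nat)
    (X : nondegenerate_subscheme k m) (p : nat) : Prop :=
  forall i, (i < p)%N -> tor_concentrated_le X i (i + 2)%N%:Z.

(* The homogeneous coordinate ring S / I is an integrally closed domain. The
   second clause says that a fraction f / g of S / I which is integral over
   S / I lies in S / I; the integral equation is multiplied by g ^+ d. *)
Definition projectively_normal (k : fieldType) (m : nat)
    (X : nondegenerate_subscheme k m) : Prop :=
  [/\ ~ X 1,
      forall f g, X (f * g) -> X f \/ X g
    & forall (f g : {mpoly k[m]}) (d : nat) (a : 'I_d -> {mpoly k[m]}),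
        ~ X g ->
        X (f ^+ d + \sum_(i < d) a i * f ^+ i * g ^+ (d - i)) ->
        exists h, X (f - h * g)].

Definition satisfies_N (k : fieldType) (m : nat)
    (X : nondegenerate_subscheme k m) (p : nat) : Prop :=
  projectively_normal X /\ satisfies_N2 X p.

(* The homogeneous ideal of a set P of points: it is generated by the forms
   vanishing on P. *)
Definition vanishing_ideal (k : fieldType) (m : nat) (P : ('I_m -> k) -> Prop)
    (f : {mpoly k[m]}) : Prop :=
  forall d x, P x -> (pihomog mdeg d f).@[x] = 0.

Section VanishingIdeal.
Variables (k : fieldType) (m : nat) (P : ('I_m -> k) -> Prop).
Local Notation I := (vanishing_ideal P).

Lemma vanishing_ideal0 : I 0.
Proof. by move=> d x _; rewrite pihomog0 meval0. Qed.

Lemma vanishing_idealD f g : I f -> I g -> I (f + g).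
Proof. by move=> If Ig d x Px; rewrite pihomogD mevalD If // Ig // addr0. Qed.

Lemma vanishing_ideal_homog d f : I f -> I (pihomog mdeg d f).
Proof.
move=> If e x Px; have [<-|ne] := eqVneq d e; first by rewrite pihomog_id If.
by rewrite (pihomog_ne0 ne (pihomogP _ _ _)) meval0.
Qed.

Lemma vanishing_idealM h f : I f -> I (h * f).
Proof.
move=> If d x Px.
rewrite {1}(pihomog_partitionE (leqnn (mmeasure mdeg h))).
rewrite {1}(pihomog_partitionE (leqnn (mmeasure mdeg f))).
rewrite mulr_suml (raddf_sum (pihomog mdeg d)) (raddf_sum (meval x)) big1 //= => a _.
rewrite mulr_sumr (raddf_sum (pihomog mdeg d)) (raddf_sum (meval x)) big1 //= => b _.
have hom := dhomogM (pihomogP mdeg a h) (pihomogP mdeg b f).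
have [ed|ne] := eqVneq (a + b)%N d; last by rewrite (pihomog_ne0 ne hom) meval0.
by rewrite pihomog_dE -?ed // mevalM If // mulr0.
Qed.

Lemma pihomogXM i d (f : {mpoly k[m]}) :
  pihomog mdeg d.+1 ('X_i * f) = 'X_i * pihomog mdeg d f.
Proof.
have fE := pihomog_partitionE (leqnn (mmeasure mdeg f)).
rewrite [in LHS]fE [in RHS]fE mulr_sumr !(raddf_sum (pihomog mdeg _)) /= mulr_sumr; apply: eq_bigr => b _.
have homX : ('X_i : {mpoly k[m]}) \is 1.-homog by rewrite dhomogX /= mdeg1.
have hom := dhomogM homX (pihomogP mdeg b f).
have [ed|ne] := eqVneq (b : nat) d.
  by rewrite -ed pihomog_id pihomog_dE.
rewrite (pihomog_ne0 ne (pihomogP _ _ _)) mulr0.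
by rewrite (pihomog_ne0 _ hom) // add1n eqSS.
Qed.

Lemma vanishing_ideal_saturated :
  (forall x, P x -> exists i, x i != 0) ->
  forall f, (forall i, I ('X_i * f)) -> I f.
Proof.
move=> P0 f If d x Px; have [i xi] := P0 x Px.
have := If i d.+1 x Px; rewrite pihomogXM mevalM mevalXU => /eqP.
by rewrite mulf_eq0 (negPf xi) => /eqP.
Qed.

Lemma vanishing_ideal_nondegenerate :
  (forall i, exists2 x, P x & x =1 (fun j => (j == i)%:R)) ->
  forall f, f \is 1.-homog -> I f -> f = 0.
Proof.
move=> Pd f homf If; apply/mpolyP => mu; rewrite mcoeff0.
have [mdmu|] := boolP (mdeg mu == 1%N); last by apply: (dhomog_nemf_coeff homf).
have /mdeg1P [i /eqP ->] := mdmu.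
have [x Px xE] := Pd i; have := If 1%N x Px.
rewrite pihomog_dE // (meval_eq _ xE) => <-.
have [|nin] := boolP (U_(i)%MM \in msupp f); last first.
  rewrite mevalE big_seq big1 ?(memN_msupp_eq0 nin) // => nu nuf.
  have := dhomog_mf homf nuf => /= /eqP /mdeg1P [j /eqP ej].
  rewrite (bigD1 j) //= ej mnm1E eqxx.
  have [eji|_] := eqVneq j i; last by rewrite expr1 mul0r mulr0.
  by move: nuf; rewrite ej eji (negPf nin).
move=> Uf; rewrite mevalE (bigD1_seq _ Uf) ?msupp_uniq //= big1 ?mulr1.
  rewrite big_seq_cond big1 ?addr0 // => nu /andP [nuf neU].
  have := dhomog_mf homf nuf => /= /eqP /mdeg1P [j /eqP ej].
  rewrite (bigD1 j) //= ej mnm1E eqxx.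
  have [eji|_] := eqVneq j i; last by rewrite expr1 mul0r mulr0.
  by move: neU; rewrite ej eji eqxx.
by move=> j _; rewrite mnm1E; case: eqVneq => _; rewrite ?expr1n ?expr0.
Qed.

End VanishingIdeal.

Section Plucker.
Variables (k : closedFieldType) (l n : nat).

(* The strictly increasing l-tuples of column indices, enumerated by
   'I_('C(n, l)). *)
Definition plucker_index (i : 'I_('C(n, l))) : l.-tuple 'I_n :=
  enum_val (cast_ord (esym (card_ltn_sorted_tuples l n)) i).

Definition plucker_coords (M : 'M[k]_(l, n)) (i : 'I_('C(n, l))) : k :=
  \det (colsub (tnth (plucker_index i)) M).

Definition Gr : {pred {vspace 'rV[k]_n}} := [pred W | \dim W == l].

(* x is a vector of Pluecker coordinates of some W in Gr(l, n), computed
   from some basis of W. *)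
Definition plucker_point (x : 'I_('C(n, l)) -> k) : Prop :=
  exists2 W : {vspace 'rV[k]_n}, W \in Gr &
  exists2 b : l.-tuple 'rV[k]_n, basis_of W b &
    x =1 plucker_coords (\matrix_(i < l) tnth b i).

Lemma plucker_index_sorted i : sorted ltn (map val (plucker_index i)).
Proof.
by have := enum_valP (cast_ord (esym (card_ltn_sorted_tuples l n)) i); rewrite inE.
Qed.

Lemma plucker_index_surj (t : l.-tuple 'I_n) :
  sorted ltn (map val t) -> exists i, plucker_index i = t.
Proof.
move=> st; have tin : t \in [set t : l.-tuple 'I_n | sorted ltn (map val t)].
  by rewrite inE.
exists (cast_ord (card_ltn_sorted_tuples l n) (enum_rank_in tin t)).
by rewrite /plucker_index cast_ordK enum_rankK_in.
Qed.

Lemma plucker_index_inj : injective plucker_index.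
Proof. by move=> i j /enum_val_inj /cast_ord_inj. Qed.

Lemma plucker_point_neq0 x : plucker_point x -> exists i, x i != 0.
Proof.
case=> W _ [b bW xE]; set M := \matrix_i _ in xE.
have rM : row_free M.
  apply: inj_row_free => v vM; apply/rowP => j; rewrite mxE.
  move/basis_free/freeP: bW => /(_ (v 0)); apply.
  by rewrite -[RHS]vM mulmx_sum_row; apply: eq_bigr => a _; rewrite rowK (tnth_nth 0).
have fT : row_full M^T by rewrite /row_full mxrank_tr.
pose f := fullrankfun fT.
have uf : colsub f M \in unitmx.
  rewrite -unitmx_tr trmx_mxsub; exact: fullrowsub_unit.
have finj : injective f := @fullrankfun_inj _ _ _ _ fT.
have [t pt st] : exists2 t : l.-tuple 'I_n,
    perm_eq [tuple f j | j < l] t & sorted ltn (map val t).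
  pose s := sort (relpre val leq) [tuple f j | j < l].
  have ps : perm_eq [tuple f j | j < l] s by rewrite perm_sym perm_sort.
  have sz : size s == l by rewrite size_sort size_tuple.
  exists (Tuple sz) => //=.
  rewrite ltn_sorted_uniq_leq map_inj_uniq; last exact: val_inj.
  rewrite sort_uniq map_inj_uniq ?enum_uniq //= sorted_map sort_sorted // => ? ?; exact: leq_total.
have [i it] := plucker_index_surj st; exists i.
have /tuple_permP [s sE] := pt.
have fE j : f j = tnth t (s j).
  have e : [tuple f j | j < l] = [tuple tnth t (s j) | j < l] by apply: val_inj.
  by have := congr1 (fun u => tnth u j) e; rewrite !tnth_mktuple.
rewrite xE /plucker_coords it -unitfE -unitmxE.
have -> : colsub (tnth t) M = col_perm s^-1 (colsub f M).
  by apply/matrixP => a c; rewrite !mxE fE permKV.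
by rewrite col_permE unitmx_mul uf unitmx_perm.
Qed.

Lemma plucker_point_delta i :
  exists2 x, plucker_point x & x =1 (fun j => (j == i)%:R).
Proof.
pose t := plucker_index i.
have ut : uniq t.
  have := plucker_index_sorted i; rewrite ltn_sorted_uniq_leq => /andP [+ _].
  by rewrite map_inj_uniq //; apply: val_inj.
pose b : l.-tuple 'rV[k]_n := [tuple delta_mx 0 (tnth t j) | j < l].
have bE (j : 'I_l) : b`_j = delta_mx 0 (tnth t j).
  by rewrite -tnth_nth tnth_mktuple.
have fb : free b.
  apply/freeP => c /rowP cE j; have := cE (tnth t j).
  rewrite summxE mxE (bigD1 j) // big1 => [|a na].
    by rewrite bE !mxE !eqxx mulr1 /= addr0.
  rewrite bE !mxE eqxx.
  case: eqP => [e|_]; last by rewrite mulr0.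
  by case/eqP: na; apply/esym/(tuple_uniqP _ ut).
exists (plucker_coords (\matrix_(j < l) tnth b j)).
  exists <<b>>%VS; first by rewrite inE (eqP fb) size_tuple.
  by exists b => //; rewrite /basis_of eqxx.
move=> j; rewrite /plucker_coords.
have [->|ne] := eqVneq j i.
  rewrite -/t (_ : colsub _ _ = 1%:M) ?det1 //.
  apply/matrixP => a c; rewrite !mxE tnth_mktuple mxE eqxx /= eq_sym.
  by rewrite (inj_eq (tuple_uniqP _ ut)) // eq_sym.
have [a na] : exists a, tnth t a \notin plucker_index j.
  apply/existsP; apply: contraT => /existsPn ha.
  case/eqP: ne; apply: plucker_index_inj; apply: val_inj; apply: (inj_map val_inj).
  apply: (@irr_sorted_eq _ ltn); [exact: ltn_trans|exact: ltnn| | |].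
  - exact: plucker_index_sorted.
  - exact: plucker_index_sorted.
  move=> x.
  have sub : {subset t <= plucker_index j}.
    by move=> y /tnthP [c ->]; have := ha c; rewrite negbK.
  have [_ e] := uniq_min_size ut sub (eq_leq (etrans (size_tuple _) (esym (size_tuple _)))).
  by apply: eq_mem_map => y; rewrite e.
rewrite (expand_det_row _ a) big1 // => c _; rewrite !mxE tnth_mktuple mxE eqxx /=.
case: eqP => [e|_]; last by rewrite mul0r.
by rewrite -e mem_tnth in na.
Qed.

(* The image of the Pluecker embedding. Since Gr(l, n) is reduced and k is
   algebraically closed, its homogeneous ideal consists of the polynomials
   that vanish at its k-points. *)
Definition plucker_grassmannian : nondegenerate_subscheme k 'C(n, l) :=
  NondegSubscheme (@vanishing_ideal0 _ _ plucker_point)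
    (@vanishing_idealD _ _ plucker_point)
    (@vanishing_idealM _ _ plucker_point)
    (@vanishing_ideal_homog _ _ plucker_point)
    (vanishing_ideal_saturated plucker_point_neq0)
    (vanishing_ideal_nondegenerate plucker_point_delta).

End Plucker.

(* Main.v *)
(* The Pluecker coordinates of Gr(l, n) contain ten linear forms L_ij, i < j <= 5,
   satisfying the relations of Gr(2, 5): for l = 2 the p_ij, for l >= 3 the p_uvwR
   with {u, v, w} the complement of {i, j} in {1, ..., 5} and R = {6, ..., l + 2}. Let
   q be the row of signed 4 x 4 Pfaffians of the skew matrix L, so that q L = 0. The
   complex S(-5) -q-> S(-3)^5 -L-> S(-2)^5 -q^T-> I lifts to any free resolution F of
   I, and the lift c in F_2 of the generator of S(-5) is a cycle of degree 5 modulo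
   (x_0, ..., x_N). If Tor_2(I, k)_5 = 0, then c may be taken to be zero modulo
   (x_0, ..., x_N).

   Now restrict to the plane L_12 = L_34 = x, L_23 = L_45 = y, L_15 = L_24 = z, all
   other L_ij = 0, where q becomes (y^2, - xz, xy + z^2, - yz, x^2). Writing
   c = x e_1 + y e_2 + z e_3 and pushing it back through F, two applications of the
   regularity of x, y, z produce an element of F_0 mapping to - z^2, so that z^2 would
   lie in the restriction of I. But the functional "coefficient of xy minus
   coefficient of z^2" on restricted quadrics is a combination of evaluations at points
   of Gr(l, n), hence kills the restriction of I. *)

From HB Require Import structures.
Require Import Defs.
From mathcomp Require Import all_boot all_order all_fingroup all_algebra.
From mathcomp Require Import mpoly zify ring.

Set Implicit Arguments.
Unset Strict Implicit.
Unset Printing Implicit Defensive.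

Import Order.TTheory GRing.Theory Num.Theory.
Local Open Scope ring_scope.

(** * The plane k[x, y, z] *)

Lemma mdeg_gt0P m (mu : 'X_{1..m}) :
  (0 < mdeg mu)%N -> exists i nu, mu = (U_(i) + nu)%MM.
Proof.
move=> mu0; have [i mui] : exists i, (0 < mu i)%N.
  apply/existsP; apply: contraTT mu0 => /existsPn h.
  by rewrite -leqNgt mdegE big1 // => i _; apply/eqP; rewrite -leqn0 leqNgt h.
by exists i, (mu - U_(i))%MM; rewrite addmC submK // lep1mP -lt0n.
Qed.

Section ThreeVariables.
Variable k : fieldType.
Local Notation T := {poly {poly {poly k}}}.

Definition cst3 : k -> T := polyC \o polyC \o polyC.
HB.instance Definition _ := GRing.RMorphism.on cst3.

Definition x3 : T := 'X.
Definition y3 : T := 'X%:P.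
Definition z3 : T := 'X%:P%:P.

Lemma polyXP (R : nzRingType) (p : {poly R}) : {q | p = q * 'X + (p`_0)%:P}.
Proof.
exists (drop_poly 1 p); apply/polyP => -[|i];
  by rewrite coefD coefMX coefC ?add0r ?addr0 //= coef_drop_poly addn1.
Qed.

Lemma const3_eq0 (t : T) : t`_0`_0`_0 = 0 ->
  exists u : T * T * T, t = u.1.1 * x3 + u.1.2 * y3 + u.2 * z3.
Proof.
move=> t0; have [p tE] := polyXP t; have [q pE] := polyXP t`_0.
have [r qE] := polyXP t`_0`_0; exists (p, q%:P, r%:P%:P) => /=.
by rewrite {1}tE {1}pE {1}qE t0 polyC0 addr0 !polyCD !polyCM addrA.
Qed.

(** Modulo [x3] the relation reads b y = 0, so [b = c * x3], and then [x3] cancels. *)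
Lemma xy3_regular (a b : T) : a * x3 + b * y3 = 0 ->
  exists c, a = - (c * y3).
Proof.
move=> ab0; have [c bE] := polyXP b.
have /eqP := congr1 (fun p : T => p`_0) ab0.
rewrite coefD coefMX coefMC coef0 /= add0r mulf_eq0 polyX_eq0 orbF => /eqP b0.
have {}bE : b = c * x3 by rewrite bE b0 polyC0 addr0.
exists c; apply/eqP; rewrite -addr_eq0.
suff : (a + c * y3) * x3 == 0 by rewrite mulf_eq0 polyX_eq0 orbF.
by rewrite -ab0 bE; apply/eqP; ring.
Qed.

(** In degree 0 in x and y only a multiple of z in k[z] survives, so [c] has no part free of x and
    y. *)
Lemma xyz3_regular (a b c : T) : a * x3 + b * y3 + c * z3 = 0 ->
  exists u : T * T, c = u.1 * x3 + u.2 * y3.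
Proof.
move=> abc0; have [p cE] := polyXP c; have [q c0E] := polyXP c`_0.
exists (p, q%:P) => /=; rewrite {1}cE {1}c0E.
have := congr1 (fun p : T => p`_0`_0) abc0.
rewrite !coefD coefMX !coefMC coef0 /= coefMX !coef0 /= !add0r.
move=> /eqP; rewrite mulf_eq0 polyX_eq0 orbF => /eqP ->.
by rewrite polyC0 addr0 polyCM.
Qed.

(* With the Gorenstein ideal (x^2, y^2, xz, yz, xy + z^2) of colength 5 in mind:
   this functional spans the orthogonal of its quadrics. *)
Definition socle3 (t : T) : k := t`_1`_1`_0 - t`_0`_0`_2.

Lemma socle3D s t : socle3 (s + t) = socle3 s + socle3 t.
Proof. by rewrite /socle3 !coefD; ring. Qed.

Lemma socle3Z c t : socle3 (cst3 c * t) = c * socle3 t.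
Proof. by rewrite /socle3 /cst3 /= !coefCM mulrBr. Qed.

Definition lin3 (a b c : k) : T := cst3 a * x3 + cst3 b * y3 + cst3 c * z3.

Lemma coef3_1 i j l : (1 : T)`_i`_j`_l = [&& i == 0, j == 0 & l == 0]%N%:R.
Proof.
rewrite coef1; case: i => [|i] /=; last by rewrite mulr0n !coef0.
rewrite mulr1n coef1; case: j => [|j] /=; last by rewrite mulr0n !coef0.
by rewrite mulr1n coef1.
Qed.

Lemma socle3_1 : socle3 1 = 0.
Proof. by rewrite /socle3 !coef3_1 subrr. Qed.

Lemma lin3_coef a b c t i j l : (lin3 a b c * t)`_i`_j`_l =
  a * (if i is i'.+1 then t`_i'`_j`_l else 0) +
  b * (if j is j'.+1 then t`_i`_j'`_l else 0) +
  c * (if l is l'.+1 then t`_i`_j`_l' else 0).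
Proof.
rewrite /lin3 !mulrDl -!mulrA !coefD /cst3 /= !coefCM !coefXM.
by case: i j l => [|i] [|j] [|l]; rewrite /= ?coef0.
Qed.

Lemma lin3_coef0 a b c t : (lin3 a b c * t)`_0`_0`_0 = 0.
Proof. by rewrite lin3_coef !mulr0 !addr0. Qed.

Lemma socle3_lin a b c t : socle3 (lin3 a b c * t) =
  a * t`_0`_1`_0 + b * t`_1`_0`_0 - c * t`_0`_0`_1.
Proof. by rewrite /socle3 !lin3_coef !mulr0 !addr0 add0r. Qed.

Lemma socle3_lin1 a b c : socle3 (lin3 a b c) = 0.
Proof.
by rewrite -[lin3 a b c]mulr1 socle3_lin !coef3_1 /= !mulr0n !mulr0 !addr0 subr0.
Qed.

(** Exhibits the functional as a symmetric bilinear form on pairs of linear forms, the form that is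
    later written as a combination of squares of points. *)
Lemma socle3_lin2 a b c a' b' c' t :
  socle3 (lin3 a b c * (lin3 a' b' c' * t)) =
  (a * b' + b * a' - c * c') * t`_0`_0`_0.
Proof. by rewrite socle3_lin !lin3_coef; ring. Qed.

Lemma coef3D s t i j l : (s + t : T)`_i`_j`_l = s`_i`_j`_l + t`_i`_j`_l.
Proof. by rewrite !coefD. Qed.

Lemma coef3Z c t i j l : (cst3 c * t)`_i`_j`_l = c * t`_i`_j`_l.
Proof. by rewrite !coefCM. Qed.

Lemma generated3 (Q : T -> Prop) :
  (forall c, Q (cst3 c)) -> Q x3 -> Q y3 -> Q z3 ->
  (forall s t, Q s -> Q t -> Q (s + t)) -> (forall s t, Q s -> Q t -> Q (s * t)) ->
  forall t, Q t.
Proof.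
move=> Qc Qx Qy Qz QD QM; elim/poly_ind => [|t c Qt].
  by rewrite -[0](rmorph0 cst3); apply: Qc.
apply: (QD (t * x3) c%:P); first exact: QM.
elim/poly_ind: c {t Qt} => [|t c Qt]; first by rewrite -[_%:P](rmorph0 cst3); apply: Qc.
rewrite polyCD polyCM; apply: (QD (t%:P * y3) c%:P%:P); first exact: QM.
elim/poly_ind: c {t Qt} => [|t c Qt]; first by rewrite -[_%:P](rmorph0 cst3); apply: Qc.
rewrite !polyCD !polyCM; apply: (QD (t%:P%:P * z3) (cst3 c)) (Qc c); exact: QM.
Qed.

Lemma y3_neq0 : y3 != 0.
Proof. by rewrite polyC_eq0 polyX_eq0. Qed.

End ThreeVariables.

(* An abstract stand-in for k[x, y, z]: computing with nested polynomials is slow,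
   and only these properties matter. *)
Record socle_ring (k : fieldType) := SocleRing {
  sring :> idomainType;
  scst : {rmorphism k -> sring};
  sx : sring;
  sy : sring;
  sz : sring;
  scoef0 : sring -> k;
  socle : sring -> k;
  slin := fun a b c => scst a * sx + scst b * sy + scst c * sz;
  sy_neq0 : sy != 0;
  sxy_regular : forall a b, a * sx + b * sy = 0 -> exists c, a = - (c * sy);
  sxyz_regular : forall a b c, a * sx + b * sy + c * sz = 0 ->
    exists u : sring * sring, c = u.1 * sx + u.2 * sy;
  sgenerated : forall Q : sring -> Prop,
    (forall c, Q (scst c)) -> Q sx -> Q sy -> Q sz ->
    (forall s t, Q s -> Q t -> Q (s + t)) -> (forall s t, Q s -> Q t -> Q (s * t)) ->
    forall t, Q t;
  scoef0_eq0 : forall t, scoef0 t = 0 ->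
    exists u : sring * sring * sring, t = u.1.1 * sx + u.1.2 * sy + u.2 * sz;
  scoef0_1 : scoef0 1 = 1;
  scoef0D : forall s t, scoef0 (s + t) = scoef0 s + scoef0 t;
  scoef0Z : forall c t, scoef0 (scst c * t) = c * scoef0 t;
  scoef0_lin : forall a b c t, scoef0 (slin a b c * t) = 0;
  socleD : forall s t, socle (s + t) = socle s + socle t;
  socleZ : forall c t, socle (scst c * t) = c * socle t;
  socle_1 : socle 1 = 0;
  socle_lin : forall a b c, socle (slin a b c) = 0;
  socle_lin2 : forall a b c a' b' c' t,
    socle (slin a b c * (slin a' b' c' * t)) =
    (a * b' + b * a' - c * c') * scoef0 t
}.

Definition poly3 (k : fieldType) : socle_ring k :=
  @SocleRing k {poly {poly {poly k}}} (@cst3 k) (x3 k) (y3 k) (z3 k)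
    (fun t => t`_0`_0`_0) (@socle3 k) (y3_neq0 k) (@xy3_regular k)
    (@xyz3_regular k) (@generated3 k) (@const3_eq0 k)
    (@coef3_1 k 0 0 0) (fun s t => coef3D s t 0 0 0) (fun c t => coef3Z c t 0 0 0)
    (@lin3_coef0 k) (@socle3D k) (@socle3Z k) (@socle3_1 k) (@socle3_lin1 k)
    (@socle3_lin2 k).

(** * Diagram chase along the regular sequence x, y, z *)

Section Chase.
Variables (T : idomainType) (x y z : T).
Hypothesis y0 : y != 0.
Hypothesis regxy : forall a b : T, a * x + b * y = 0 ->
  exists c, a = - (c * y).
Hypothesis regxyz : forall a b c : T, a * x + b * y + c * z = 0 ->
  exists u : T * T, c = u.1 * x + u.2 * y.

Lemma regxy_row r (a b : 'rV[T]_r) : x *: a + y *: b = 0 ->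
  exists c, a = - (y *: c).
Proof.
move=> ab0.
have ab0j j : a 0 j * x + b 0 j * y = 0.
  by have /rowP/(_ j) := ab0; rewrite !mxE => h; rewrite -[RHS]h; ring.
have /fin_all_exists [h hE] := fun j => regxy (ab0j j).
by exists (\row_j h j); apply/rowP => j; rewrite hE !mxE mulrC.
Qed.

Lemma regxyz_row r (a b c : 'rV[T]_r) :
  x *: a + y *: b + z *: c = 0 -> exists u v, c = x *: u + y *: v.
Proof.
move=> abc0.
have abc0j j : a 0 j * x + b 0 j * y + c 0 j * z = 0.
  by have /rowP/(_ j) := abc0; rewrite !mxE => h; rewrite -[RHS]h; ring.
have /fin_all_exists [h hE] := fun j => regxyz (abc0j j).
exists (\row_j (h j).1), (\row_j (h j).2).
by apply/rowP => j; rewrite hE !mxE; ring.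
Qed.

(** [D] and [ep] stand for the restricted maps F_1 -> F_0 -> I, the rows [a] and [b] for lifts of
    the complex, and the [g] for the images in F_1 of the components e_1, e_2, e_3 of c. *)
Lemma pentagon_chase r0 r1 (D : 'M[T]_(r1, r0)) (ep : 'cV[T]_r0)
    (a2 a4 : 'rV[T]_r0) (b1 b2 b3 b4 b5 g1 g2 g3 : 'rV[T]_r1) :
  D *m ep = 0 -> g3 *m D = 0 -> b3 *m D = x *: a4 - y *: a2 ->
  a4 *m ep = (- (y * z))%:M ->
  y ^+ 2 *: b1 - (x * z) *: b2 + (x * y + z ^+ 2) *: b3 - (y * z) *: b4
    + x ^+ 2 *: b5 = x *: g1 + y *: g2 + z *: g3 ->
  exists m, m *m ep = (- z ^+ 2)%:M.
Proof.
move=> Dep g3D b3D a4ep eqb.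
(* Modulo x and y the relation reads z (z b3 - g3) = 0. *)
have [u [v uv]] : exists u v, z *: b3 - g3 = x *: u + y *: v.
  apply: (@regxyz_row _ (x *: b5 + y *: b3 - z *: b2 - g1)
                              (y *: b1 - z *: b4 - g2)).
  apply/rowP => j; move/rowP/(_ j)/eqP: eqb; rewrite -subr_eq0.
  by rewrite !mxE => /eqP h; rewrite -[RHS]h; ring.
have uvD := congr1 (mulmx^~ D) uv.
rewrite /= mulmxBl g3D -scalemxAl b3D subr0 mulmxDl -!scalemxAl in uvD.
(* Applying [D] kills [g3] and leaves x (u D - z a4) + y (v D + z a2) = 0. *)
have [c cE] : exists c, u *m D - z *: a4 = - (y *: c).
  apply: (@regxy_row _ _ (v *m D + z *: a2)).
  apply/rowP => j; move/rowP/(_ j)/eqP: uvD; rewrite eq_sym -subr_eq0.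
  by rewrite !mxE => /eqP h; rewrite -[RHS]h; ring.
(* Applying [ep] kills [u *m D], and y cancels from y z^2 = - y (c ep). *)
exists c; have := congr1 (mulmx^~ ep) cE.
rewrite /= mulmxBl -mulmxA Dep mulmx0 sub0r mulNmx -!scalemxAl a4ep.
move: (c *m ep) => e /matrixP/(_ 0 0); rewrite !mxE mulr1n => h.
apply/matrixP => i j; rewrite !ord1 !mxE mulr1n.
apply: (mulfI y0); apply: oppr_inj; rewrite -h; ring.
Qed.

End Chase.

(** * Lifting complexes to a graded resolution *)

Section GradedLift.
Variables (k : fieldType) (m : nat).
Local Notation S := {mpoly k[m]}.

(** Degrees are integers because [row_part] subtracts generator degrees; S is zero in negative
    degrees. *)
Definition homog_part (j : int) (p : S) : S :=
  if j is Posz d then pihomog mdeg d p else 0.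

Lemma pihomogM d b e (p q : S) : q \is e.-homog ->
  pihomog mdeg d (pihomog mdeg b p * q) =
    if (b + e == d)%N then pihomog mdeg b p * q else 0.
Proof.
move=> hq; have h := dhomogM (pihomogP mdeg b p) hq.
by case: eqVneq => [<-|ne]; [rewrite pihomog_dE | rewrite (pihomog_ne0 ne h)].
Qed.

(** The hypothesis has the shape of the homogeneity fields of a resolution. It constrains [e] only
    for nonzero [q], and then [e] is a natural number. *)
Lemma homog_partM j (e : int) (p q : S) :
  (forall mu, mu \in msupp q -> (mdeg mu)%:Z = e) ->
  homog_part j (p * q) = homog_part (j - e) p * q.
Proof.
move=> hq; have [->|q0] := eqVneq q 0.
  by rewrite !mulr0; case: j => j //=; rewrite pihomog0.
have [mu muq] : exists mu, mu \in msupp q.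
  by move: q0; rewrite -msupp_eq0; case: (msupp q) => // mu s _; exists mu;
    rewrite mem_head.
have {mu muq} [d ed] : exists d, e = Posz d by exists (mdeg mu); rewrite hq.
have hqd : q \is d.-homog.
  by apply/dhomogP => mu /hq; rewrite ed => -[].
case: j => j; last first.
  by rewrite (_ : Negz j - e = Negz (j + d)) ?mul0r // ed !NegzE; ring.
have pE := pihomog_partitionE (leqnn (mmeasure mdeg p)).
have [ltjd|ledj] := ltnP j d.
  rewrite (_ : Posz j - e = Negz (d - j).-1) /= ?mul0r; last first.
    by rewrite NegzE prednK ?subn_gt0 // -subzn 1?ltnW // ed; ring.
  rewrite /= {1}pE mulr_suml (raddf_sum (pihomog mdeg j)) big1 //= => b _.
  rewrite (pihomogM _ _ _ hqd).
  by case: eqP => // h; move: ltjd; rewrite -h ltnNge leq_addl.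
rewrite ed subzn //= {1}pE [in RHS]pE mulr_suml !(raddf_sum (pihomog mdeg _)) mulr_suml.
apply: eq_bigr => b _; rewrite /= (pihomogM _ _ _ hqd).
have -> : (b + d == j)%N = (b == j - d :> nat)%N.
  by rewrite -[RHS](eqn_add2r d) subnK.
case: eqVneq => [<-|ne]; first by rewrite pihomog_id.
by rewrite (pihomog_ne0 ne (pihomogP _ _ _)) mul0r.
Qed.

Lemma homog_part0 j : homog_part j 0 = 0.
Proof. by case: j => j //=; rewrite pihomog0. Qed.

Lemma homog_partD j : {morph homog_part j : p q / p + q}.
Proof. by case: j => j p q /=; rewrite ?pihomogD ?addr0. Qed.

HB.instance Definition _ j := GRing.isNmodMorphism.Build S S (homog_part j)
  (conj (homog_part0 j) (homog_partD j)).

(** The component of degree [j] in the graded module \bigoplus_c S(- gd c). *)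
Definition row_part r (gd : 'I_r -> int) (j : int) (u : 'rV[S]_r) : 'rV[S]_r :=
  \row_c homog_part (j - gd c) (u 0 c).

Lemma row_partM r s (gd : 'I_r -> int) (gd' : 'I_s -> int) (D : 'M[S]_(r, s)) j u :
  (forall a b mu, mu \in msupp (D a b) -> (mdeg mu)%:Z = gd a - gd' b) ->
  row_part gd' j (u *m D) = row_part gd j u *m D.
Proof.
move=> hD; apply/rowP => b; rewrite !mxE raddf_sum; apply: eq_bigr => a _ /=.
by rewrite (homog_partM _ _ (hD a b)) !mxE; congr (homog_part _ _ * _); ring.
Qed.

Lemma row_partD r (gd : 'I_r -> int) j u v :
  row_part gd j (u + v) = row_part gd j u + row_part gd j v.
Proof. by apply/rowP => c; rewrite !mxE raddfD. Qed.

Lemma row_partZ r (gd : 'I_r -> int) (j d : nat) (q : S) u : q \is d.-homog ->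
  row_part gd (j + d)%N (q *: u) = q *: row_part gd j u.
Proof.
move=> /dhomogP hq; apply/rowP => c.
rewrite !mxE mulrC [RHS]mulrC (@homog_partM _ d); last by move=> mu /hq ->.
by congr (homog_part _ _ * _); rewrite PoszD; ring.
Qed.

End GradedLift.

Section ResolutionLift.
Variables (k : fieldType) (m : nat) (I : {mpoly k[m]} -> Prop).
Variable F : graded_free_resolution I.
Local Notation S := {mpoly k[m]}.

Lemma gdiff_gdiff i : gdiff F i.+1 *m gdiff F i = 0.
Proof.
apply/row_matrixP => a; rewrite row_mul row0; apply/gexactS.
by exists (delta_mx 0 a); rewrite rowE.
Qed.

Lemma gdiff_gaug : gdiff F 0 *m gaug F = 0.
Proof.
apply/row_matrixP => a; rewrite row_mul row0; apply/gexact0.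
by exists (delta_mx 0 a); rewrite rowE.
Qed.

Lemma row_part_gaug j (u : 'rV_(grank F 0)) (f : S) :
  u *m gaug F = f%:M -> row_part (@gdeg _ _ _ F 0) j u *m gaug F = (homog_part j f)%:M.
Proof.
move=> uf; rewrite -(@row_partM _ _ _ _ _ (fun=> 0)) ?uf.
  by apply/rowP => c; rewrite !mxE subr0 ord1 eqxx !mulr1n.
by move=> a b mu; rewrite ord1 subr0 => /gaug_homog.
Qed.

Lemma row_part_gdiff i j (u : 'rV_(grank F i.+1)) :
  row_part (@gdeg _ _ _ F i) j (u *m gdiff F i) =
  row_part (@gdeg _ _ _ F i.+1) j u *m gdiff F i.
Proof. by apply: row_partM => a b mu /gdiff_homog. Qed.

(* Lifts to F the start S(-5) -> S(-3)^r -> S(-2)^r -> I of a complex. *)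
Lemma homogeneous_lift r (A : 'M[S]_r) (q : 'rV[S]_r) :
  (forall i j, A i j \is 1.-homog) -> (forall i, q 0 i \is 2.-homog) ->
  (forall i, I (q 0 i)) -> q *m A = 0 -> A *m q^T = 0 ->
  exists (a : 'M_(r, grank F 0)) (b : 'M_(r, grank F 1)) (c : 'rV_(grank F 2)),
  [/\ a *m gaug F = q^T, b *m gdiff F 0 = A *m a,
      c *m gdiff F 1 = q *m b & c = row_part (@gdeg _ _ _ F 2) 5%:Z c].
Proof.
move=> A1 q2 Iq qA Aq.
have row_sum s t (u : 'rV[S]_s) (v : 'M_(s, t)) : u *m v = \sum_i u 0 i *: row i v.
  exact: mulmx_sum_row.
(* Lifts of the q_i can be cut down to degree 2, since the augmentation preserves degree and q_i is
   already homogeneous. *)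
have [a [aE a2]] : exists a : 'M_(r, grank F 0), a *m gaug F = q^T /\
    forall i, row_part (@gdeg _ _ _ F 0) 2 (row i a) = row i a.
  have /fin_all_exists [h hE] := fun i => (gaug_image F (q 0 i)).1 (Iq i).
  exists (\matrix_i row_part (@gdeg _ _ _ F 0) 2 (h i)); split.
    apply/row_matrixP => i; rewrite row_mul rowK (row_part_gaug _ (hE i)) /=.
    by rewrite pihomog_dE ?q2 //; apply/rowP => j; rewrite !mxE ord1 eqxx mulr1n.
  move=> i; rewrite rowK; apply/rowP => c; rewrite !mxE.
  by case: (2%:Z - _) => d //=; rewrite pihomog_id.
(* The rows of A a map to A q^T = 0 in I, so they come from F_1, in degree 1 + 2. *)
have [b [bE b3]] : exists b : 'M_(r, grank F 1), b *m gdiff F 0 = A *m a /\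
    forall i, row_part (@gdeg _ _ _ F 1) 3 (row i b) = row i b.
  have lift i : exists v, row i A *m a = v *m gdiff F 0.
    by apply/gexact0; rewrite -mulmxA aE -row_mul Aq row0.
  have /fin_all_exists [h hE] := lift.
  exists (\matrix_i row_part (@gdeg _ _ _ F 1) 3 (h i)); split.
    apply/row_matrixP => i; rewrite !row_mul rowK -row_part_gdiff -hE.
    rewrite row_sum; apply: (big_ind (fun u => row_part _ 3 u = u)).
    - by apply/rowP => c; rewrite !mxE homog_part0.
    - by move=> u v hu hv; rewrite row_partD hu hv.
    by move=> j _; rewrite (@row_partZ _ _ _ _ 2 1) ?mxE ?A1 // a2.
  move=> i; rewrite rowK; apply/rowP => c; rewrite !mxE.
  by case: (3%:Z - _) => d //=; rewrite pihomog_id.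
(* q b maps to q A a = 0 in F_0, so it comes from F_2, in degree 2 + 3. *)
have [c cE] : exists c, q *m b = c *m gdiff F 1.
  by apply/gexactS; rewrite -mulmxA bE mulmxA qA mul0mx.
exists a, b, (row_part (@gdeg _ _ _ F 2) 5%:Z c); split=> //.
  rewrite -row_part_gdiff -cE row_sum; apply: (big_ind (fun u => row_part _ 5 u = u)).
  - by apply/rowP => j; rewrite !mxE homog_part0.
  - by move=> u v hu hv; rewrite row_partD hu hv.
  by move=> j _; rewrite (@row_partZ _ _ _ _ 3 2) ?q2 // b3.
apply/rowP => j; rewrite !mxE.
by case: (5%:Z - _) => d //=; rewrite pihomog_id.
Qed.

(** The constant terms of [c] form a cycle of degree 5, hence a boundary of some [w]. Subtracting
    [w *m gdiff F 2], with [w] seen as a row of constants, clears them without changing the image in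
    F_1. *)
Lemma tor2_lift (c : 'rV_(grank F 2)) :
  tor_homology_eq0 F 2 5%:Z -> c = row_part (@gdeg _ _ _ F 2) 5%:Z c ->
  (forall j, ((c *m gdiff F 1) 0 j)@_0 = 0) ->
  exists2 c' : 'rV_(grank F 2), c' *m gdiff F 1 = c *m gdiff F 1 &
    forall j, (c' 0 j)@_0 = 0.
Proof.
move=> tor0 c5 cD0; pose v := map_mx (mcoeff 0) c.
have [||w _ wE] := tor0 v.
(* An entry homogeneous of degree [5 - gdeg j] has a constant term only if [gdeg j = 5]. *)
- move=> j; rewrite mxE c5 mxE; case: (5%:Z - _) (subrK (gdeg j) 5%:Z) => d /= hd.
    have [d0 _|d0] := posnP d; first by rewrite -hd d0 add0r.
    rewrite (dhomog_nemf_coeff (pihomogP _ _ _)) ?eqxx //.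
    by rewrite /= mdeg0 eq_sym -lt0n.
  by rewrite mcoeff0 eqxx.
- rewrite /= /tor_diff -map_mxM; apply/rowP => j.
  by rewrite mxE [RHS]mxE /= cD0.
exists (c - map_mx (@mpolyC m k) w *m gdiff F 2).
  by rewrite mulmxBl -mulmxA gdiff_gdiff mulmx0 subr0.
move=> j; have /rowP/(_ j) := wE; rewrite !mxE => h; rewrite mcoeffB -h.
rewrite (raddf_sum (mcoeff 0)) /= -sumrB big1 // => i _.
by rewrite !mxE mcoeffCM subrr.
Qed.

End ResolutionLift.

(** * Restriction to the plane *)

Section Restriction.
Variables (k : fieldType) (R : socle_ring k) (m : nat) (al be ga : 'I_m -> k).
Implicit Types f g : {mpoly k[m]}.

(** Pullback along the linear map (x, y, z) |-> x al + y be + z ga. *)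
Definition res3 : {mpoly k[m]} -> R :=
  mmap (scst R) (fun i => slin R (al i) (be i) (ga i)).
HB.instance Definition _ := GRing.RMorphism.on res3.

Lemma res3Z c f : res3 (c *: f) = scst R c * res3 f.
Proof. exact: mmapZ. Qed.

Lemma res3D f g : res3 (f + g) = res3 f + res3 g.
Proof. exact: mmapD. Qed.

Lemma res3U i : res3 'X_i = slin R (al i) (be i) (ga i).
Proof. by rewrite /res3 mmapX mmap1U. Qed.

Lemma res3_coef0 f : scoef0 (res3 f) = f@_0.
Proof.
elim/mpolyind: f => [|c mu f _ _ IH].
  by rewrite -(scale0r 0) res3Z scoef0Z mul0r mcoeffZ mul0r.
rewrite res3D res3Z scoef0D scoef0Z IH mcoeffD mcoeffZ mcoeffX; congr (c * _ + _).
have [->|] := eqVneq mu 0%MM.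
  by rewrite mpolyX0 rmorph1 scoef0_1.
rewrite -mdeg_eq0 -lt0n => /mdeg_gt0P[i [nu ->]].
by rewrite mpolyXD rmorphM /= res3U scoef0_lin.
Qed.

(** After restriction [socle] sees only the quadratic part of [f], through the bilinear form on the
    left of the hypothesis. Writing that form as a weighted sum of squares of points turns it into
    evaluations at these points. *)
Lemma socle_res3 (pts : seq (k * ('I_m -> k))) f :
  (forall i j, al i * be j + be i * al j - ga i * ga j =
    \sum_(w <- pts) w.1 * (w.2 i * w.2 j)) ->
  socle (res3 f) =
    \sum_(w <- pts) w.1 * (pihomog mdeg 2 f).@[w.2].
Proof.
move=> sumE; elim/mpolyind: f => [|c mu f _ _ IH].
  rewrite -[in LHS](scale0r 0) res3Z socleZ mul0r big1 // => w _.
  by rewrite pihomog0 meval0 mulr0.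
rewrite res3D socleD [X in _ + X]IH res3Z socleZ.
under [RHS]eq_bigr do rewrite pihomogD mevalD mulrDr.
rewrite big_split /=; congr (_ + _).
under eq_bigr do rewrite linearZ /= mevalZ mulrCA.
rewrite -mulr_sumr; congr (c * _).
have [mu0|/mdeg_gt0P[i [nu ->]]] := posnP (mdeg mu).
  rewrite (eqP (etrans (esym (mdeg_eq0 _)) (introT eqP mu0))) mpolyX0 rmorph1 big1.
    exact: socle_1.
  by move=> w _; rewrite -mpolyX0 pihomogX /= mdeg0 meval0 mulr0.
have [nu0|/mdeg_gt0P[j [rho ->]]] := posnP (mdeg nu).
  rewrite (eqP (etrans (esym (mdeg_eq0 _)) (introT eqP nu0))) addm0 res3U big1.
    exact: socle_lin.
  by move=> w _; rewrite pihomogX /= mdeg1 meval0 mulr0.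
rewrite mpolyXD rmorphM mpolyXD rmorphM /= !res3U socle_lin2 res3_coef0 sumE.
rewrite mcoeffX mulr_suml; apply: eq_bigr => w _.
rewrite -!mpolyXD pihomogX /= !mdegD !mdeg1 !addnA !add1n !eqSS mdeg_eq0.
have [->|_] := eqVneq rho 0%MM; last by rewrite mulr0 meval0 mulr0.
by rewrite addm0 mulr1 mpolyXD mevalM !mevalXU.
Qed.

(** Needed to lift the outcome of the chase, which lives over [R], back to a row over the polynomial
    ring. *)
Lemma res3_surj :
  (exists p, res3 p = sx R) -> (exists p, res3 p = sy R) ->
  (exists p, res3 p = sz R) -> forall t, exists p, res3 p = t.
Proof.
move=> hx hy hz; apply: sgenerated => // [c | s t [p <-] [q <-] | s t [p <-] [q <-]].
- by exists c%:MP; rewrite /res3 mmapC.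
- by exists (p + q); rewrite rmorphD.
by exists (p * q); rewrite rmorphM.
Qed.

End Restriction.

Section LinearForms.
Variables (k : fieldType) (m : nat).
Implicit Types (f : {mpoly k[m]}) (x y : 'I_m -> k).

Lemma dhomog1E f : f \is 1.-homog -> f = \sum_i f@_U_(i) *: 'X_i.
Proof.
move=> f1; apply/mpolyP => mu; rewrite (raddf_sum (mcoeff mu)) /=.
have [/mdeg1P [i /eqP ->]|nmu] := boolP (mdeg mu == 1%N).
  rewrite (bigD1 i) //= mcoeffZ mcoeffX eqxx mulr1 big1 ?addr0 // => j ne.
  rewrite mcoeffZ mcoeffX; case: eqP => [/(congr1 (fun nu : 'X_{1..m} => nu i))|].
    by rewrite !mnm1E eqxx (negPf ne).
  by rewrite mulr0.
rewrite (dhomog_nemf_coeff f1) // big1 // => i _.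
rewrite mcoeffZ mcoeffX; case: (U_(i)%MM =P mu) nmu => [<-|_ _].
  by rewrite mdeg1.
by rewrite mulr0.
Qed.

Lemma meval_dhomog1 f x : f \is 1.-homog -> f.@[x] = \sum_i f@_U_(i) * x i.
Proof.
move=> f1; rewrite {1}(dhomog1E f1) (raddf_sum (meval x)) /=.
by apply: eq_bigr => i _; rewrite mevalZ mevalXU.
Qed.

Lemma meval_dhomog1D f x y : f \is 1.-homog ->
  f.@[fun i => x i + y i] = f.@[x] + f.@[y].
Proof.
move=> f1; rewrite !meval_dhomog1 // -big_split.
by apply: eq_bigr => i _; rewrite mulrDr.
Qed.

Lemma slinD (R : socle_ring k) (a b c a' b' c' : k) :
  slin R a b c + slin R a' b' c' = slin R (a + a') (b + b') (c + c').
Proof. by rewrite /slin !rmorphD; ring. Qed.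

Lemma slinZ (R : socle_ring k) (d a b c : k) :
  scst R d * slin R a b c = slin R (d * a) (d * b) (d * c).
Proof. by rewrite /slin !rmorphM; ring. Qed.

Lemma slin0 (R : socle_ring k) : slin R 0 0 0 = 0.
Proof. by rewrite /slin rmorph0; ring. Qed.

Lemma res3_dhomog1 (R : socle_ring k) (al be ga : 'I_m -> k) f : f \is 1.-homog ->
  res3 R al be ga f = slin R f.@[al] f.@[be] f.@[ga].
Proof.
move=> f1; rewrite {1}(dhomog1E f1) !meval_dhomog1 // (raddf_sum (res3 R al be ga)).
elim: (index_enum _) => [|i s IH]; first by rewrite !big_nil slin0.
by rewrite !big_cons -slinD -slinZ IH /= res3Z res3U.
Qed.

End LinearForms.

(** * Nonvanishing of Tor_2 for a pentagonal configuration of points *)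

Section Pentagon.
Variables (k : fieldType) (R : socle_ring k) (m : nat) (P : ('I_m -> k) -> Prop).
Variables (L : nat -> nat -> {mpoly k[m]}) (e : nat -> nat -> 'I_m -> k).

Definition pfaffian4 a b c d : {mpoly k[m]} :=
  L a b * L c d - L a c * L b d + L a d * L b c.

Hypothesis L1 : forall i j, L i j \is 1.-homog.
Hypothesis L_pfaffian : forall x, P x ->
  [/\ (pfaffian4 2 3 4 5).@[x] = 0, (pfaffian4 1 3 4 5).@[x] = 0,
      (pfaffian4 1 2 4 5).@[x] = 0, (pfaffian4 1 2 3 5).@[x] = 0
    & (pfaffian4 1 2 3 4).@[x] = 0].
Hypothesis L_dual : forall i j i' j', (0 < i < j)%N -> (j <= 5)%N ->
  (0 < i' < j')%N -> (j' <= 5)%N -> (L i j).@[e i' j'] = ((i == i') && (j == j'))%:R.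

Hypothesis Pe : forall i j, (0 < i < j)%N -> (j <= 5)%N -> P (e i j).
Hypothesis P1223 : P (fun t => e 1 2 t + e 2 3 t).
Hypothesis P3423 : P (fun t => e 3 4 t + e 2 3 t).
Hypothesis P3445 : P (fun t => e 3 4 t + e 4 5 t).
Hypothesis P1215 : P (fun t => e 1 2 t + e 1 5 t).
Hypothesis P1224 : P (fun t => e 1 2 t + e 2 4 t).
Hypothesis P1545 : P (fun t => e 1 5 t + e 4 5 t).
Hypothesis P2445 : P (fun t => e 2 4 t + e 4 5 t).
Hypothesis Psquare : P (fun t => e 1 2 t + e 1 5 t - e 2 4 t + e 4 5 t).

(** By duality of the L_ij and e_ij, these three vectors span the plane on which L_12 = L_34 = x,
    L_23 = L_45 = y, L_15 = L_24 = z and the other L_ij vanish. *)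
Let al t := e 1 2 t + e 3 4 t.
Let be t := e 2 3 t + e 4 5 t.
Let ga t := e 1 5 t + e 2 4 t.
Local Notation rho := (res3 R al be ga).

Lemma socle_vanishing f : vanishing_ideal P f -> socle (rho f) = 0.
Proof.
move=> If.
pose pts : seq (k * ('I_m -> k)) :=
  [:: (1, fun t => e 1 2 t + e 2 3 t); (1, fun t => e 3 4 t + e 2 3 t);
      (1, fun t => e 3 4 t + e 4 5 t); (- 1, fun t => e 1 2 t + e 1 5 t);
      (1, fun t => e 1 2 t + e 2 4 t); (- 1, fun t => e 1 5 t + e 4 5 t);
      (1, fun t => e 2 4 t + e 4 5 t);
      (1, fun t => e 1 2 t + e 1 5 t - e 2 4 t + e 4 5 t);
      (- 2, e 1 2); (- 2, e 3 4); (- 2, e 2 3); (- 2, e 4 5); (- 4, e 2 4)].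
(* the combination polarises: (u + v)^2 - u^2 - v^2 yields the product of u and v,
   and the fourfold sum yields e_12 e_45 - e_15 e_24 *)
rewrite (@socle_res3 _ R _ _ _ _ pts); last first.
  by move=> i j; rewrite /pts !big_cons big_nil /= /al /be /ga; ring.
rewrite /pts !big_cons big_nil /= !If ?mulr0 ?addr0 //; exact: Pe.
Qed.

Lemma rhoL i j : (0 < i < j)%N -> (j <= 5)%N ->
  rho (L i j) = slin R ((i == 1) && (j == 2) || (i == 3) && (j == 4))%N%:R
                     ((i == 2) && (j == 3) || (i == 4) && (j == 5))%N%:R
                     ((i == 1) && (j == 5) || (i == 2) && (j == 4))%N%:R.
Proof.
move=> ij j5; rewrite res3_dhomog1; last exact: L1.
congr (slin R _ _ _);
  rewrite meval_dhomog1D // !L_dual // -natrD; congr _%:R;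
  by case: eqP => [->|_] //=; rewrite addn0 orbF.
Qed.

Lemma rhoL12 : rho (L 1 2) = sx R.
Proof. by rewrite rhoL //= /slin !(rmorph0, rmorph1); ring. Qed.

Lemma rhoL34 : rho (L 3 4) = sx R.
Proof. by rewrite rhoL //= /slin !(rmorph0, rmorph1); ring. Qed.

Lemma rhoL23 : rho (L 2 3) = sy R.
Proof. by rewrite rhoL //= /slin !(rmorph0, rmorph1); ring. Qed.

Lemma rhoL45 : rho (L 4 5) = sy R.
Proof. by rewrite rhoL //= /slin !(rmorph0, rmorph1); ring. Qed.

Lemma rhoL15 : rho (L 1 5) = sz R.
Proof. by rewrite rhoL //= /slin !(rmorph0, rmorph1); ring. Qed.

Lemma rhoL24 : rho (L 2 4) = sz R.
Proof. by rewrite rhoL //= /slin !(rmorph0, rmorph1); ring. Qed.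

Lemma rhoL13 : rho (L 1 3) = 0.
Proof. by rewrite rhoL //= /slin !(rmorph0, rmorph1); ring. Qed.

Lemma rhoL14 : rho (L 1 4) = 0.
Proof. by rewrite rhoL //= /slin !(rmorph0, rmorph1); ring. Qed.

Lemma rhoL25 : rho (L 2 5) = 0.
Proof. by rewrite rhoL //= /slin !(rmorph0, rmorph1); ring. Qed.

Lemma rhoL35 : rho (L 3 5) = 0.
Proof. by rewrite rhoL //= /slin !(rmorph0, rmorph1); ring. Qed.

Definition skew5 : 'M[{mpoly k[m]}]_5 :=
  \matrix_(i, j) if (i < j)%N then L i.+1 j.+1
                 else if (j < i)%N then - L j.+1 i.+1 else 0.

Definition pfaffians5 : 'rV[{mpoly k[m]}]_5 :=
  \row_i [:: pfaffian4 2 3 4 5; - pfaffian4 1 3 4 5; pfaffian4 1 2 4 5;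
             - pfaffian4 1 2 3 5; pfaffian4 1 2 3 4]`_i.

Lemma pfaffians5_skew5 : pfaffians5 *m skew5 = 0.
Proof.
apply/rowP => j; rewrite !mxE !big_ord_recl big_ord0 !mxE /=.
by case: j => [[|[|[|[|[|j]]]]] hj] //=; rewrite /pfaffian4 /bump /=; ring.
Qed.

Lemma skew5_pfaffians5 : skew5 *m pfaffians5^T = 0.
Proof.
have skew : skew5^T = - skew5.
  apply/matrixP => i j; rewrite !mxE.
  by case: ltngtP => _; rewrite ?opprK ?oppr0.
apply: trmx_inj; rewrite trmx_mul trmxK trmx0 skew mulmxN.
by rewrite pfaffians5_skew5 oppr0.
Qed.

Lemma pfaffian4_dhomog a b c d : pfaffian4 a b c d \is 2.-homog.
Proof.
by rewrite /pfaffian4 rpredD ?rpredB // (dhomogM (L1 _ _) (L1 _ _)).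
Qed.

Lemma pfaffian4_vanishing a b c d :
  (forall x, P x -> (pfaffian4 a b c d).@[x] = 0) ->
  vanishing_ideal P (pfaffian4 a b c d).
Proof.
move=> pf0 e0 x Px; have [<-|ne] := eqVneq 2 e0.
  by rewrite (pihomog_dE (pfaffian4_dhomog _ _ _ _)) pf0.
by rewrite (pihomog_ne0 ne (pfaffian4_dhomog _ _ _ _)) meval0.
Qed.

Lemma pfaffians5_dhomog i : pfaffians5 0 i \is 2.-homog.
Proof.
by case: i => [[|[|[|[|[|j]]]]] hj] //; rewrite mxE /= ?rpredN; apply: pfaffian4_dhomog.
Qed.

Lemma pfaffians5_vanishing i : vanishing_ideal P (pfaffians5 0 i).
Proof.
case: i => [[|[|[|[|[|j]]]]] hj] //; rewrite mxE /=.
- by apply: pfaffian4_vanishing => x /L_pfaffian[].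
- by rewrite -mulN1r; apply/vanishing_idealM/pfaffian4_vanishing => x /L_pfaffian[].
- by apply: pfaffian4_vanishing => x /L_pfaffian[].
- by rewrite -mulN1r; apply/vanishing_idealM/pfaffian4_vanishing => x /L_pfaffian[].
by apply: pfaffian4_vanishing => x /L_pfaffian[].
Qed.

Lemma skew5_dhomog i j : skew5 i j \is 1.-homog.
Proof. by rewrite mxE; case: ifP => _; [|case: ifP => _]; rewrite ?rpredN ?rpred0. Qed.

Theorem pentagon_tor2 (F : graded_free_resolution (vanishing_ideal P)) :
  ~ tor_homology_eq0 F 2 5%:Z.
Proof.
move=> tor0.
have [a [b [c [aE bE cE c5]]]] := homogeneous_lift F skew5_dhomog pfaffians5_dhomog
  pfaffians5_vanishing pfaffians5_skew5 skew5_pfaffians5.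
(* The image of [c] in F_1 is q b, and the entries of q are quadrics, so it has no constant
   terms. *)
have [j|c' c'E c'0] := tor2_lift tor0 c5.
  rewrite cE mxE (raddf_sum (mcoeff 0)) big1 // => i _ /=.
  rewrite (rmorphM (mcoeff 0)) /= (dhomog_nemf_coeff (pfaffians5_dhomog i)) ?mul0r //.
  by rewrite /= mdeg0.
(* Entries without constant term restrict into the ideal (x, y, z). *)
have [e0 c'R] : exists e : 'rV[R]_(grank F 2) * 'rV[R]_(grank F 2) * 'rV[R]_(grank F 2),
    map_mx rho c' = sx R *: e.1.1 + sy R *: e.1.2 + sz R *: e.2.
  have h j : scoef0 (rho (c' 0 j)) = 0 by rewrite res3_coef0 c'0.
  have /fin_all_exists [u uE] := fun j => scoef0_eq0 (h j).
  exists (\row_j (u j).1.1, \row_j (u j).1.2, \row_j (u j).2) => /=.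
  by apply/rowP => j; rewrite [LHS]mxE uE !mxE; ring.
pose D := map_mx rho (gdiff F 0); pose D1 := map_mx rho (gdiff F 1).
pose ep := map_mx rho (gaug F).
pose ra i := row i (map_mx rho a); pose rb i := row i (map_mx rho b).
have D1D : D1 *m D = 0 by rewrite -map_mxM gdiff_gdiff map_mx0.
pose i1 := @Ordinal 5 0 isT; pose i2 := @Ordinal 5 1 isT; pose i3 := @Ordinal 5 2 isT;
pose i4 := @Ordinal 5 3 isT; pose i5 := @Ordinal 5 4 isT.
have sum5 (V : zmodType) (E : 'I_5 -> V) :
    \sum_i E i = E i1 + (E i2 + (E i3 + (E i4 + E i5))).
  rewrite !big_ord_recl big_ord0 addr0.
  by congr (E _ + (E _ + (E _ + (E _ + E _)))); apply: val_inj.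
(* The third row of the skew matrix restricts to (0, - y, 0, x, 0) and the fourth entry of q to -
   yz; this supplies the hypotheses on [b3] and [a4]. *)
have [|||||M ME] := @pentagon_chase R (sx R) (sy R) (sz R) (sy_neq0 R) (@sxy_regular _ R)
  (@sxyz_regular _ R) _ _ D ep (ra i2) (ra i4) (rb i1) (rb i2) (rb i3) (rb i4) (rb i5)
  (e0.1.1 *m D1) (e0.1.2 *m D1) (e0.2 *m D1).
- by rewrite -map_mxM gdiff_gaug map_mx0.
- by rewrite -mulmxA D1D mulmx0.
- rewrite /rb /D -row_mul -map_mxM bE map_mxM row_mul mulmx_sum_row sum5.
  rewrite !mxE /= !rmorphN rmorph0 /= rhoL13 rhoL23 rhoL34 rhoL35.
  by rewrite oppr0 !scale0r !add0r !addr0 addrC scaleNr.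
- rewrite /ra /ep -row_mul -map_mxM aE; apply/matrixP => u v; rewrite !ord1 !mxE /= mulr1n.
  rewrite rmorphN /pfaffian4 !(rmorphD, rmorphN, rmorphM) /=.
  by rewrite rhoL12 rhoL13 rhoL15 rhoL23 rhoL25 rhoL35; ring.
- have := congr1 (map_mx rho) cE; rewrite -c'E !map_mxM c'R !mulmxDl -!scalemxAl => ->.
  rewrite mulmx_sum_row sum5 !mxE /= /pfaffian4.
  rewrite !(rmorphD, rmorphN, rmorphM) /=.
  rewrite rhoL12 rhoL13 rhoL14 rhoL15 rhoL23 rhoL24 rhoL25 rhoL34 rhoL35 rhoL45.
  by apply/rowP => j; rewrite !mxE; ring.
(* A lift of [M] to F_0 has as augmentation an element of I that restricts to - z^2. *)
have [sg sgE] : exists sg : 'rV_(grank F 0), map_mx rho sg = M.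
  have surj t : exists p, rho p = t.
    apply: res3_surj; by [exists (L 1 2); exact: rhoL12 | exists (L 2 3); exact: rhoL23
      | exists (L 1 5); exact: rhoL15].
  have /fin_all_exists [u uE] := fun j => surj (M 0 j).
  by exists (\row_j u j); apply/rowP => j; rewrite !mxE.
pose f := (sg *m gaug F) 0 0.
have If : vanishing_ideal P f.
  by apply/(gaug_image F); exists sg; rewrite [LHS]mx11_scalar.
have := socle_vanishing If.
have -> : rho f = - sz R ^+ 2.
  have := ME; rewrite -sgE -map_mxM => /matrixP/(_ 0 0).
  by rewrite mxE => ->; rewrite mxE mulr1n.
(* In this form [socle] evaluates to 1, whereas it vanishes on the restriction of I. *)
have -> : - sz R ^+ 2 = scst R (- 1) * (slin R 0 0 1 * (slin R 0 0 1 * 1)).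
  by rewrite /slin rmorphN rmorph1 rmorph0; ring.
rewrite socleZ socle_lin2 scoef0_1 => /eqP.
by rewrite !mul0r add0r sub0r !mulr1 mulN1r opprK oner_eq0.
Qed.

End Pentagon.

(** * Determinants and Pluecker coordinates *)

Section SeqDeterminant.
Variables (k : fieldType) (T : Type) (x0 : T) (l : nat) (F : T -> 'I_l -> k).

(** Sequences make it easy to exchange or expand leading rows. [T] is instantiated both by column
    indices, giving minors, and by row vectors, giving wedge products. *)
Definition det_seq (s : seq T) : k := \det (\matrix_(a, b) F (nth x0 s a) b).

Lemma det_seq_swap s t (i j : 'I_l) : i != j ->
  nth x0 s i = nth x0 t j -> nth x0 s j = nth x0 t i ->
  (forall a : 'I_l, a != i -> a != j -> nth x0 s a = nth x0 t a) ->
  det_seq s = - det_seq t.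
Proof.
move=> ne sij sji sE; rewrite /det_seq -[RHS]mulN1r.
have -> : -1 = \det (tperm_mx i j : 'M[k]_l) by rewrite det_perm odd_tperm ne expr1.
rewrite -det_mulmx -xrowE; congr (\det _); apply/matrixP => a b.
by rewrite !mxE; case: tpermP => [->|->|/eqP ai /eqP aj]; rewrite ?sij ?sji ?sE.
Qed.

End SeqDeterminant.

Section SeqDeterminantHead.
Variables (k : fieldType) (T : Type) (x0 : T) (l : nat) (F : T -> 'I_l -> k).
Local Notation D := (det_seq x0 F).

Lemma det_seq_swap01 u v s : (1 < l)%N -> D [:: u, v & s] = - D [:: v, u & s].
Proof.
move=> l1; apply: (@det_seq_swap _ _ _ _ _ _ _ (Ordinal (ltnW l1)) (Ordinal l1)) => //.
by case=> [[|[|a]]] ?.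
Qed.

Lemma det_seq_swap12 u v w s : (2 < l)%N ->
  D [:: u, v, w & s] = - D [:: u, w, v & s].
Proof.
move=> l2; apply: (@det_seq_swap _ _ _ _ _ _ _ (Ordinal (ltnW l2)) (Ordinal l2)) => //.
by case=> [[|[|[|a]]]] ?.
Qed.

End SeqDeterminantHead.

Section SeqDeterminantLinear.
Variables (k : fieldType) (n l : nat) (f : 'I_l -> 'I_n).
Local Notation D := (det_seq (0 : 'rV[k]_n) (fun v b => v 0 (f b))).

Lemma det_seq_lin0 (al be : k) u v s : (0 < l)%N ->
  D (al *: u + be *: v :: s) = al * D (u :: s) + be * D (v :: s).
Proof.
move=> l0; apply: (@determinant_multilinear _ _ _ _ _ (Ordinal l0)).
- by apply/rowP => b; rewrite !mxE.
- by apply/matrixP => a b; rewrite !mxE.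
- by apply/matrixP => a b; rewrite !mxE.
Qed.

Lemma det_seq_lin1 (al be : k) w u v s : (1 < l)%N ->
  D [:: w, al *: u + be *: v & s] = al * D [:: w, u & s] + be * D [:: w, v & s].
Proof.
move=> l1; rewrite det_seq_swap01 // det_seq_lin0 ?(ltnW l1) //.
by rewrite ![D [:: w, _ & _]]det_seq_swap01 //; ring.
Qed.

End SeqDeterminantLinear.

Lemma det_mx2 (R : comPzRingType) (A : 'M[R]_2) :
  \det A = A 0 0 * A 1 1 - A 0 1 * A 1 0.
Proof.
rewrite (expand_det_row _ 0) !big_ord_recl big_ord0 /cofactor !det_mx11 !mxE.
have e1 : lift (ord0 : 'I_2) (ord0 : 'I_1) = 1 by apply: val_inj.
have e0 : lift (1 : 'I_2) (ord0 : 'I_1) = 0 by apply: val_inj.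
rewrite e1 e0; move: (A 0 0) (A 0 1) (A 1 0) (A 1 1) => a b c d.
by rewrite addr0 expr0 mul1r expr1 mulN1r mulrN.
Qed.

(* A nonzero maximal minor normalises the columns r to unit vectors, and then the
   remaining minors are 2 x 2. *)
Lemma det_seq_decomposable (k : fieldType) (T : finType) (x0 : T) (l : nat)
    (F : T -> 'I_l.+2 -> k) (r : seq T) : size r = l ->
  exists p q : T -> k, forall u w,
    det_seq x0 F [:: u, w & r] = p u * q w - p w * q u.
Proof.
move=> sr; case: (pickP (fun uw : T * T => det_seq x0 F [:: uw.1, uw.2 & r] != 0));
  last first.
  move=> D0; exists (fun=> 0), (fun=> 0) => u w; rewrite !mul0r subrr.
  by apply/eqP; have := D0 (u, w) => /negbT; rewrite negbK.
case=> u0 w0 /= D0; set s0 := [:: u0, w0 & r] in D0.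
pose K s := \matrix_(a, b) F (nth x0 s a) b : 'M_l.+2.
have uK : K s0 \in unitmx by rewrite unitmxE unitfE.
pose c x := (\row_b F x b) *m invmx (K s0).
have cE s a : row a (K s *m invmx (K s0)) = c (nth x0 s a).
  by rewrite row_mul; congr (_ *m _); apply/rowP => b; rewrite !mxE.
have cr a : (a < l)%N -> forall h : (a.+2 < l.+2)%N,
    c (nth x0 r a) = delta_mx 0 (Ordinal h).
  by move=> al h; rewrite -(cE s0 (Ordinal h)) mulmxV // row1.
(* [c x] holds the coordinates of the row of [x] in the rows of [K s0]; the factor [\det (K s0)] is
   absorbed by the first function alone. *)
exists (fun x => \det (K s0) * c x 0 0), (fun x => c x 0 1) => u w.
pose B : 'M_(2 + l) := K [:: u, w & r] *m invmx (K s0).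
have BE a b : B a b = c (nth x0 [:: u, w & r] a) 0 b by rewrite -cE [RHS]mxE.
have -> : det_seq x0 F [:: u, w & r] = \det B * \det (K s0).
  by rewrite -det_mulmx mulmxKV.
(* The rows of [B] that come from [r] are unit vectors, so [B] is block upper triangular with an
   identity block, and its determinant is that of a 2 x 2 block. *)
have rE (a : 'I_l) (b : 'I_(2 + l)) : B (rshift 2 a) b = (rshift 2 a == b)%:R.
  have h : (a.+2 < l.+2)%N := ltn_ord a.
  rewrite BE (_ : nth _ _ _ = nth x0 r a) // (cr _ (ltn_ord a) h) mxE eqxx /=.
  by rewrite -!val_eqE eq_sym.
have Bdl : dlsubmx B = 0.
  apply/matrixP => a b; rewrite [LHS]mxE [LHS]mxE rE [RHS]mxE.
  by case: eqP => // /(congr1 val) /= h; move: (ltn_ord b); rewrite -h.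
have Bdr : drsubmx B = 1%:M.
  by apply/matrixP => a b; rewrite [LHS]mxE [LHS]mxE rE [RHS]mxE (inj_eq (@rshift_inj _ _)).
have -> : \det B = \det (ulsubmx B).
  by rewrite -[B in LHS]submxK Bdl Bdr det_ublock det1 mulr1.
have ulE a b : ulsubmx B a b = B (lshift l a) (lshift l b) by rewrite 2![LHS]mxE.
have l0 : lshift l (0 : 'I_2) = 0 by apply: val_inj.
have l1 : lshift l (1 : 'I_2) = 1 by apply: val_inj.
by rewrite det_mx2 !ulE l0 l1 !BE /=; ring.
Qed.

(** * Coordinate forms and decomposable vectors *)

Section PluckerForms.
Variables (k : closedFieldType) (l n : nat).
Local Notation N := 'C(n.+1, l).

Definition minor (M : 'M[k]_(l, n.+1)) (s : seq 'I_n.+1) : k :=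
  det_seq ord0 (fun j b => M b j) s.

(** Coordinates are indexed by sorted tuples only; for an arbitrary order of the letters this is the
    coordinate of the sorted tuple with the sign of the sorting permutation. *)
Definition plucker_form (s : seq 'I_n.+1) : {mpoly k[N]} :=
  if [pick p : 'I_N * 'S_l |
       [forall a : 'I_l, nth ord0 s a == tnth (plucker_index p.1) (p.2 a)]] is Some p
  then (-1) ^+ p.2 *: 'X_(p.1) else 0.

Definition wedge (vs : seq 'rV[k]_n.+1) : 'I_N -> k :=
  plucker_coords (\matrix_(a < l) nth 0 vs a).

Lemma plucker_form_dhomog s : plucker_form s \is 1.-homog.
Proof.
rewrite /plucker_form; case: pickP => [p _|_]; last exact: rpred0.
by rewrite rpredZ // dhomogX /= mdeg1.
Qed.

Lemma plucker_index_perm (s : seq 'I_n.+1) : size s = l -> uniq s ->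
  exists (i : 'I_N) (p : 'S_l), forall a : 'I_l,
    nth ord0 s a = tnth (plucker_index i) (p a).
Proof.
move=> /eqP sl us; pose t := sort (relpre val leq) s.
have tl : size t == l by rewrite size_sort.
have [|i iE] := @plucker_index_surj l n.+1 (Tuple tl).
  rewrite /= ltn_sorted_uniq_leq map_inj_uniq ?sort_uniq ?us /=; last exact: val_inj.
  by rewrite sorted_map sort_sorted // => ? ?; apply: leq_total.
have pst : perm_eq (Tuple sl) (Tuple tl) by rewrite /= perm_sym perm_sort.
have /tuple_permP[p pE] := pst; exists i, p => a; rewrite iE.
have e : Tuple sl = [tuple tnth (Tuple tl) (p a) | a < l] by apply: val_inj.
by have := congr1 (fun u => tnth u a) e; rewrite tnth_mktuple (tnth_nth ord0).
Qed.

Lemma plucker_formE M s : size s = l -> uniq s ->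
  (plucker_form s).@[plucker_coords M] = minor M s.
Proof.
move=> sl us; rewrite /plucker_form; case: pickP => [[i p] /= /forallP pE|h].
  rewrite mevalZ mevalXU /plucker_coords /minor /det_seq -det_perm.
  rewrite -[\det (colsub _ _)]det_tr -det_mulmx -row_permE.
  congr (\det _); apply/matrixP => a b.
  by rewrite !mxE (eqP (pE a)).
have [i [p pE]] := plucker_index_perm sl us.
by have /negP[] := negbT (h (i, p)); apply/forallP => a; rewrite pE.
Qed.

(** A nonzero maximal minor makes the rows of [M] independent, so they are a basis of a point of Gr;
    one linear form with nonzero value certifies such a minor. *)
Lemma plucker_point_neq0P x M (f : {mpoly k[N]}) : f \is 1.-homog ->
  x =1 plucker_coords M -> f.@[x] != 0 -> plucker_point x.
Proof.
move=> f1 xM fx.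
have [i xi] : exists i, x i != 0.
  apply/existsP; apply: contraNT fx => /existsPn x0.
  rewrite meval_dhomog1 // big1 // => i _; have /negPn/eqP -> := x0 i.
  by rewrite mulr0.
have uM : colsub (tnth (plucker_index i)) M \in unitmx.
  by rewrite unitmxE unitfE -[X in X != 0]xM.
pose b : l.-tuple 'rV[k]_n.+1 := [tuple row a M | a < l].
have bE (a : 'I_l) : b`_a = row a M by rewrite -tnth_nth tnth_mktuple.
have fb : free b.
  apply/freeP => c cb a; have : (\row_a c a) *m M = 0.
    rewrite mulmx_sum_row -[RHS]cb; apply: eq_bigr => j _.
    by rewrite mxE bE.
  move=> /(congr1 (colsub (tnth (plucker_index i)))).
  rewrite -mulmx_colsub => /(congr1 (mulmx^~ (invmx (colsub (tnth (plucker_index i)) M)))).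
  rewrite /= mulmxK // (_ : colsub _ 0 = 0) ?mul0mx; last first.
    by apply/matrixP => ? ?; rewrite !mxE.
  by move/rowP/(_ a); rewrite !mxE.
exists <<b>>%VS; first by rewrite inE (eqP fb) size_tuple.
exists b; first by rewrite /basis_of eqxx.
move=> j; rewrite xM; congr (plucker_coords _ _); apply/matrixP => u v.
by rewrite mxE tnth_mktuple mxE.
Qed.

Lemma wedgeE vs i :
  wedge vs i = det_seq 0 (fun (v : 'rV[k]_n.+1) b => v 0 (tnth (plucker_index i) b)) vs.
Proof. by congr (\det _); apply/matrixP => a b; rewrite !mxE. Qed.

(** A letter of [t] outside [s] gives a zero row in the minor. The case of a nontrivial reordering,
    where a sign would appear, is excluded by the last hypothesis. *)
Lemma plucker_form_wedge s t : size s = l -> uniq s -> size t = l ->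
  (s == t) || has (fun x => x \notin s) t ->
  (plucker_form s).@[wedge [seq delta_mx 0 j | j <- t]] = (s == t)%:R.
Proof.
move=> sl us tl; rewrite plucker_formE // /minor /det_seq.
have mE (a b : 'I_l) : (\matrix_(a < l) nth 0 [seq delta_mx 0 j | j <- t] a :
    'M[k]_(l, n.+1)) b (nth ord0 s a) = (nth ord0 s a == nth ord0 t b)%:R.
  by rewrite mxE (nth_map ord0) ?tl // mxE eqxx.
case: (eqVneq s t) => [st _|_ /= /(hasP)[x xt xs]].
  rewrite (_ : \matrix_(a, b) _ = 1%:M) ?det1 //; apply/matrixP => a b.
  by rewrite mxE mE -st nth_uniq ?sl // [RHS]mxE.
rewrite -det_tr; have xl : (index x t < l)%N by rewrite -tl index_mem.
rewrite (expand_det_row _ (Ordinal xl)) big1 // => b _.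
rewrite mxE [X in X * _]mxE mE /= nth_index //.
case: eqP => [e|_]; last by rewrite mul0r.
by rewrite -e mem_nth ?sl in xs.
Qed.

End PluckerForms.

Lemma meval_dhomog1N (k : fieldType) (m : nat) (f : {mpoly k[m]}) x :
  f \is 1.-homog -> f.@[fun i => - x i] = - f.@[x].
Proof.
move=> f1; rewrite !meval_dhomog1 // -sumrN.
by apply: eq_bigr => i _; rewrite mulrN.
Qed.

(** * From ten index sequences to Tor_2 of the Grassmannian *)

Section GrassmannianSection.
Variables (k : closedFieldType) (l n : nat) (S : nat -> nat -> seq 'I_n.+1).

Local Notation e i j :=
  (@wedge k l n [seq delta_mx 0 x | x <- S i j]).
Local Notation D M i j := (@minor k l n M (S i j)).

Hypothesis S_size : forall i j, (0 < i < j)%N -> (j <= 5)%N -> size (S i j) = l.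
Hypothesis S_uniq : forall i j, (0 < i < j)%N -> (j <= 5)%N -> uniq (S i j).
Hypothesis S_dual : forall i j i' j', (0 < i < j)%N -> (j <= 5)%N ->
  (0 < i' < j')%N -> (j' <= 5)%N ->
  if (i == i') && (j == j') then S i j == S i' j'
  else has (fun x => x \notin S i j) (S i' j').

Definition minor_pfaffian M a b c d :=
  D M a b * D M c d - D M a c * D M b d + D M a d * D M b c.

Hypothesis S_pfaffian : forall M,
  [/\ minor_pfaffian M 2 3 4 5 = 0, minor_pfaffian M 1 3 4 5 = 0,
      minor_pfaffian M 1 2 4 5 = 0, minor_pfaffian M 1 2 3 5 = 0
    & minor_pfaffian M 1 2 3 4 = 0].

Hypothesis D1223 : exists vs, (fun t => e 1 2 t + e 2 3 t) =1 wedge vs.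
Hypothesis D3423 : exists vs, (fun t => e 3 4 t + e 2 3 t) =1 wedge vs.
Hypothesis D3445 : exists vs, (fun t => e 3 4 t + e 4 5 t) =1 wedge vs.
Hypothesis D1215 : exists vs, (fun t => e 1 2 t + e 1 5 t) =1 wedge vs.
Hypothesis D1224 : exists vs, (fun t => e 1 2 t + e 2 4 t) =1 wedge vs.
Hypothesis D1545 : exists vs, (fun t => e 1 5 t + e 4 5 t) =1 wedge vs.
Hypothesis D2445 : exists vs, (fun t => e 2 4 t + e 4 5 t) =1 wedge vs.
Hypothesis Dsquare :
  exists vs, (fun t => e 1 2 t + e 1 5 t - e 2 4 t + e 4 5 t) =1 wedge vs.

Lemma plucker_tor2
    (F : graded_free_resolution (vanishing_ideal (@plucker_point k l n.+1))) :
  ~ tor_homology_eq0 F 2 5%:Z.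
Proof.
pose L i j := @plucker_form k l n (S i j).
have L1 i j : L i j \is 1.-homog by exact: plucker_form_dhomog.
have Ldual i j i' j' : (0 < i < j)%N -> (j <= 5)%N -> (0 < i' < j')%N -> (j' <= 5)%N ->
    (L i j).@[e i' j'] = ((i == i') && (j == j'))%:R.
  move=> ij j5 ij' j5'; have := S_dual ij j5 ij' j5'.
  have [[ss us] ss'] := (S_size ij j5, S_uniq ij j5, S_size ij' j5').
  case: ifP => _ h; rewrite plucker_form_wedge ?h ?orbT //.
  by case: eqP h => // -> /hasP[x ->].
(* A decomposable sum of the e_ij is nonzero because the form dual to one of its terms takes the
   value 1 on it. *)
have pt i j x vs : (L i j).@[x] = 1 -> x =1 wedge vs -> plucker_point x.
  by move=> Lx xw; apply: (plucker_point_neq0P (L1 i j) xw); rewrite Lx oner_neq0.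
apply: (@pentagon_tor2 k (poly3 k) _ _ L (fun i j => e i j)) => //.
- move=> x [W _ [b _ xE]].
  have pf i j i' j' : (0 < i < j)%N -> (j <= 5)%N -> (0 < i' < j')%N -> (j' <= 5)%N ->
     (L i j * L i' j').@[x] =
       D (\matrix_(a < l) tnth b a) i j * D (\matrix_(a < l) tnth b a) i' j'.
    move=> ij j5 ij' j5'; rewrite !(meval_eq _ xE) mevalM.
    by rewrite !plucker_formE ?S_size ?S_uniq.
  have [h1 h2 h3 h4 h5] := S_pfaffian (\matrix_(a < l) tnth b a).
  by split; rewrite /pfaffian4 mevalD mevalB !pf.
- by move=> i j ij j5; apply: (pt i j _ _ _ (frefl _)); rewrite Ldual // !eqxx.
- have [vs] := D1223; apply: (pt 1 2); by rewrite meval_dhomog1D // !Ldual // addr0.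
- have [vs] := D3423; apply: (pt 3 4); by rewrite meval_dhomog1D // !Ldual // addr0.
- have [vs] := D3445; apply: (pt 3 4); by rewrite meval_dhomog1D // !Ldual // addr0.
- have [vs] := D1215; apply: (pt 1 2); by rewrite meval_dhomog1D // !Ldual // addr0.
- have [vs] := D1224; apply: (pt 1 2); by rewrite meval_dhomog1D // !Ldual // addr0.
- have [vs] := D1545; apply: (pt 1 5); by rewrite meval_dhomog1D // !Ldual // addr0.
- have [vs] := D2445; apply: (pt 2 4); by rewrite meval_dhomog1D // !Ldual // addr0.
have [vs] := Dsquare; apply: (pt 1 2).
by rewrite !meval_dhomog1D // meval_dhomog1N // !Ldual // subr0 !addr0.
Qed.

End GrassmannianSection.

Section Letters.
Variable n : nat.

(** Letters count from 1, to match the pairs i < j <= 5; 0 and 1 give the same column, whence the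
    bounds 0 < x below. *)
Definition letter (x : nat) : 'I_n.+1 := inord x.-1.

Lemma letter_inj x y : (0 < x <= n.+1)%N -> (0 < y <= n.+1)%N ->
  letter x = letter y -> x = y.
Proof.
case: x y => [|x] [|y] //= hx hy /(congr1 val).
by rewrite /letter /= !inordK // => ->.
Qed.

Lemma letters_uniq s : {in s, forall x, (0 < x <= n.+1)%N} -> uniq s ->
  uniq (map letter s).
Proof.
move=> hs us; rewrite map_inj_in_uniq // => x y xs ys.
by apply: letter_inj; apply: hs.
Qed.

Lemma letters_notin s t : {in s, forall x, (0 < x <= n.+1)%N} ->
  {in t, forall x, (0 < x <= n.+1)%N} -> has (fun x => x \notin s) t ->
  has (fun x => x \notin map letter s) (map letter t).
Proof.
move=> hs ht /hasP[x xt xs]; apply/hasP; exists (letter x); first exact: map_f.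
apply: contra xs => /mapP[y ys xy].
by rewrite (letter_inj (ht _ xt) (hs _ ys) xy).
Qed.

End Letters.

(** * The case l = 2 *)

Section Lines.
Variables (k : closedFieldType) (n : nat).
Hypothesis n5 : (5 <= n.+1)%N.

(** With e_ij = e_i /\ e_j each required sum of points is a product of two vectors, such as (e_1 -
    e_3) /\ e_2 = e_12 + e_23 and (e_1 + e_4) /\ (e_2 + e_5) = e_12 + e_15 - e_24 + e_45. *)
Lemma plucker_lines_tor2
    (F : graded_free_resolution (vanishing_ideal (@plucker_point k 2 n.+1))) :
  ~ tor_homology_eq0 F 2 5%:Z.
Proof.
pose S i j := map (letter n) [:: i; j].
have letterP i j : (0 < i < j)%N -> (j <= 5)%N ->
    {in [:: i; j], forall x, (0 < x <= n.+1)%N}.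
  move=> /andP[i0 ij] j5 x; rewrite !inE => /orP[] /eqP ->.
    by rewrite i0 (leq_trans (leq_trans (ltnW ij) j5)).
  by rewrite (leq_ltn_trans _ ij) // (leq_trans j5).
pose d x : 'rV[k]_n.+1 := delta_mx 0 (letter n x).
(* Expansion of (a x + b y) /\ (c u + d' v); a zero coefficient leaves a single vector in a
   factor. *)
have comb (x y u v : nat) (a b c d' : k) : exists vs, (fun t =>
    a * c * wedge [:: d x; d u] t + a * d' * wedge [:: d x; d v] t +
    b * c * wedge [:: d y; d u] t + b * d' * wedge [:: d y; d v] t) =1 @wedge k 2 n vs.
  exists [:: a *: d x + b *: d y; c *: d u + d' *: d v] => t.
  by rewrite !wedgeE det_seq_lin0 // !det_seq_lin1 //; ring.
have sw x y t : wedge [:: d x; d y] t = - @wedge k 2 n [:: d y; d x] t.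
  by rewrite !wedgeE det_seq_swap01.
have red (f g : 'I_('C(n.+1, 2)) -> k) : f =1 g ->
    (exists vs, f =1 @wedge k 2 n vs) -> exists vs, g =1 @wedge k 2 n vs.
  by move=> fg [vs fE]; exists vs => t; rewrite -fg.
apply: (@plucker_tor2 k 2 n S) => //.
- move=> i j ij j5; apply: letters_uniq; first exact: letterP.
  by rewrite /= inE andbT neq_ltn; case/andP: ij => _ ->.
- move=> i j i' j' ij j5 ij' j5'; case: ifP => [/andP[/eqP -> /eqP -> //]|h].
  apply: letters_notin; [exact: letterP|exact: letterP|].
  by move: h ij ij'; rewrite /= !inE; lia.
- move=> M.
  (* The Pfaffians vanish identically on the brackets p_i q_j - p_j q_i. *)
  have [p [q pq]] := @det_seq_decomposable k _ ord0 0 (fun j b => M b j) [::] erefl.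
  by split; rewrite /minor_pfaffian /minor !pq; ring.
- apply: red (comb 1%N 3%N 2%N 2%N 1 (- 1) 1 0) => t; rewrite (sw 3 2)%N /=; ring.
- apply: red (comb 4%N 2%N 3%N 3%N (- 1) 1 1 0) => t; rewrite (sw 4 3)%N /=; ring.
- apply: red (comb 3%N 5%N 4%N 4%N 1 (- 1) 1 0) => t; rewrite (sw 5 4)%N /=; ring.
- apply: red (comb 1%N 1%N 2%N 5%N 1 0 1 1) => t /=; ring.
- apply: red (comb 1%N 4%N 2%N 2%N 1 (- 1) 1 0) => t; rewrite (sw 4 2)%N /=; ring.
- apply: red (comb 1%N 4%N 5%N 5%N 1 1 1 0) => t /=; ring.
- apply: red (comb 2%N 5%N 4%N 4%N 1 (- 1) 1 0) => t; rewrite (sw 5 4)%N /=; ring.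
apply: red (comb 1%N 4%N 2%N 5%N 1 1 1 1) => t; rewrite (sw 4 2)%N /=; ring.
Qed.

End Lines.

(** * The case l >= 3, with [l.+3] in place of l *)

Section Planes.
Variables (k : closedFieldType) (n l : nat).
Hypothesis ln : (l + 5 <= n.+1)%N.

(* The complement [u; v; w] of {i, j} in {1, ..., 5}, ordered so that
   (i, j, u, v, w) is an even permutation. *)
Definition coline (i j : nat) : seq nat :=
  match i, j with
  | 1, 2 => [:: 3; 4; 5] | 1, 3 => [:: 2; 5; 4] | 1, 4 => [:: 2; 3; 5]
  | 1, 5 => [:: 2; 4; 3] | 2, 3 => [:: 1; 4; 5] | 2, 4 => [:: 1; 5; 3]
  | 2, 5 => [:: 1; 3; 4] | 3, 4 => [:: 1; 2; 5] | 3, 5 => [:: 1; 4; 2]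
  | _, _ => [:: 1; 2; 3]
  end%N.

(** Complements of two pairs that share an index have two letters in common, so the sum of their
    wedges is decomposable. The four complements in the last sum all contain 3, and it equals (e_1 -
    e_4) /\ (e_2 - e_5) /\ e_3 /\ R. *)
Lemma plucker_planes_tor2
    (F : graded_free_resolution (vanishing_ideal (@plucker_point k l.+3 n.+1))) :
  ~ tor_homology_eq0 F 2 5%:Z.
Proof.
pose r := iota 6 l.
pose S i j := map (letter n) (coline i j ++ r).
have coline_size i j : size (coline i j) = 3.
  by case: i j => [|[|[|[|i]]]] [|[|[|[|[|[|j]]]]]].
have coline_uniq i j : uniq (coline i j).
  by case: i j => [|[|[|[|i]]]] [|[|[|[|[|[|j]]]]]].
have colineP i j : {in coline i j, forall x, (0 < x <= 5)%N}.
  by apply/allP; case: i j => [|[|[|[|i]]]] [|[|[|[|[|[|j]]]]]].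
have letterP i j : {in coline i j ++ r, forall x, (0 < x <= n.+1)%N}.
  move=> x; rewrite mem_cat => /orP[/colineP /andP[-> x5]|].
    by rewrite (leq_trans x5) // (leq_trans _ ln) // leq_addl.
  by rewrite mem_iota; move: ln; lia.
pose d x : 'rV[k]_n.+1 := delta_mx 0 (letter n x).
pose w x y z : 'I_('C(n.+1, l.+3)) -> k := wedge [:: d x, d y, d z & map d r].
have comb (x y u v z : nat) (a b c d' : k) : exists vs, (fun t =>
    a * c * w x u z t + a * d' * w x v z t +
    b * c * w y u z t + b * d' * w y v z t) =1 @wedge k l.+3 n vs.
  exists [:: a *: d x + b *: d y, c *: d u + d' *: d v, d z & map d r] => t.
  by rewrite /w !wedgeE det_seq_lin0 // !det_seq_lin1 //; ring.
have sw01 x y z t : w x y z t = - w y x z t.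
  by rewrite /w !wedgeE det_seq_swap01.
have sw12 x y z t : w x y z t = - w x z y t.
  by rewrite /w !wedgeE det_seq_swap12.
have red (f g : 'I_('C(n.+1, l.+3)) -> k) : f =1 g ->
    (exists vs, f =1 @wedge k l.+3 n vs) -> exists vs, g =1 @wedge k l.+3 n vs.
  by move=> fg [vs fE]; exists vs => t; rewrite -fg.
have wE i j x y z : coline i j = [:: x; y; z] ->
    @wedge k l.+3 n [seq delta_mx 0 x | x <- S i j] = w x y z.
  by move=> ijE; rewrite /S ijE /w /= -map_comp.
have w12 := wE 1%N 2%N _ _ _ erefl; have w23 := wE 2%N 3%N _ _ _ erefl.
have w34 := wE 3%N 4%N _ _ _ erefl; have w45 := wE 4%N 5%N _ _ _ erefl.
have w15 := wE 1%N 5%N _ _ _ erefl; have w24 := wE 2%N 4%N _ _ _ erefl.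
apply: (@plucker_tor2 k l.+3 n S).
- by move=> i j _ _; rewrite size_map size_cat coline_size size_iota.
- move=> i j _ _; apply: letters_uniq; first exact: letterP.
  rewrite cat_uniq coline_uniq iota_uniq andbT; apply/hasPn => x.
  by rewrite mem_iota; apply: contraL => /colineP; lia.
- move=> i j i' j' ij j5 ij' j5'; case: ifP => [/andP[/eqP -> /eqP -> //]|h].
  apply: letters_notin; [exact: letterP|exact: letterP|].
  (* Both sequences end in R, so the missing letter must come from the complements, and distinct
     pairs have distinct three-letter complements. *)
  suff /hasP[x xij xij'] : has (fun x => x \notin coline i j) (coline i' j').
    apply/hasP; exists x; rewrite mem_cat ?xij // negb_or xij' mem_iota.
    by have := colineP _ _ _ xij; lia.
  move: h ij j5 ij' j5'.
  by case: i j i' j' => [|[|[|[|[|i]]]]] [|[|[|[|[|[|j]]]]]]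
    [|[|[|[|[|i']]]]] [|[|[|[|[|[|j']]]]]].
- move=> M; pose m x y z := @det_seq k _ ord0 l.+3 (fun j b => M b j)
    [:: letter n x, letter n y, letter n z & map (letter n) r].
  have mE i j x y z : coline i j = [:: x; y; z] -> minor M (S i j) = m x y z.
    by move=> ijE; rewrite /minor /S ijE.
  (* Cyclic rotations are even, so any of the three letters can be moved to the last place. *)
  have rot1 x y z : m x y z = m y z x.
    by rewrite /m det_seq_swap01 // det_seq_swap12 // opprK.
  have rot2 x y z : m x y z = m z x y by rewrite [RHS]rot1.
  (* All six minors in the Pfaffian that omits the index c contain the letter c; with c and R fixed
     they become 2 x 2 brackets. *)
  have three_term c : exists p q : nat -> k, forall u v, m u v c = p u * q v - p v * q u.
    have [|p [q pq]] := @det_seq_decomposable k _ ord0 l.+1 (fun j b => M b j)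
      (letter n c :: map (letter n) r); first by rewrite /= size_map size_iota.
    by exists (p \o letter n), (q \o letter n) => u v; rewrite /m pq.
  rewrite /minor_pfaffian.
  rewrite (mE 1%N 2%N _ _ _ erefl) (mE 1%N 3%N _ _ _ erefl) (mE 1%N 4%N _ _ _ erefl).
  rewrite (mE 1%N 5%N _ _ _ erefl) (mE 2%N 3%N _ _ _ erefl) (mE 2%N 4%N _ _ _ erefl).
  rewrite (mE 2%N 5%N _ _ _ erefl) (mE 3%N 4%N _ _ _ erefl) (mE 3%N 5%N _ _ _ erefl).
  rewrite (mE 4%N 5%N _ _ _ erefl); split.
  + have [p [q pq]] := three_term 1%N; by rewrite (rot1 1%N 4%N 5%N) (rot1 1%N 5%N 3%N)
    (rot1 1%N 3%N 4%N) (rot1 1%N 2%N 5%N) (rot1 1%N 4%N 2%N) (rot1 1%N 2%N 3%N) !pq;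
    ring.
  + have [p [q pq]] := three_term 2%N; by rewrite (rot1 2%N 5%N 4%N) (rot1 2%N 3%N 5%N)
    (rot1 2%N 4%N 3%N) (rot2 1%N 2%N 5%N) (rot2 1%N 2%N 3%N) !pq; ring.
  + have [p [q pq]] := three_term 3%N; by rewrite (rot1 3%N 4%N 5%N) (rot2 2%N 3%N 5%N)
    (rot2 1%N 3%N 4%N) !pq; ring.
  + have [p [q pq]] := three_term 4%N; by rewrite (rot2 3%N 4%N 5%N) (rot2 2%N 4%N 3%N)
    (rot2 1%N 4%N 5%N) (rot2 1%N 4%N 2%N) !pq; ring.
  have [p [q pq]] := three_term 5%N; by rewrite (rot2 2%N 5%N 4%N) (rot2 1%N 5%N 3%N)
    !pq; ring.
- by apply: red (comb 3%N 1%N 4%N 4%N 5%N 1 1 1 0) => t; rewrite w12 w23; ring.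
- apply: red (comb 2%N 4%N 1%N 1%N 5%N (- 1) (- 1) 1 0) => t.
  by rewrite w34 w23 (sw01 1 2 5)%N (sw01 1 4 5)%N; ring.
- apply: red (comb 5%N 3%N 1%N 1%N 2%N 1 1 1 0) => t.
  by rewrite w34 w45 (sw01 5 1 2)%N (sw12 1 5 2)%N (sw01 3 1 2)%N (sw12 1 3 2)%N; ring.
- apply: red (comb 5%N 2%N 3%N 3%N 4%N 1 (- 1) 1 0) => t.
  by rewrite w12 w15 (sw01 5 3 4)%N (sw12 3 5 4)%N (sw12 2 4 3)%N; ring.
- apply: red (comb 4%N 1%N 5%N 5%N 3%N 1 1 1 0) => t.
  by rewrite w12 w24 (sw12 4 5 3)%N (sw01 4 3 5)%N; ring.
- apply: red (comb 1%N 4%N 2%N 2%N 3%N 1 (- 1) 1 0) => t.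
  by rewrite w15 w45 (sw01 2 4 3)%N; ring.
- apply: red (comb 5%N 2%N 3%N 3%N 1%N 1 1 1 0) => t.
  by rewrite w24 w45 (sw12 5 3 1)%N (sw01 5 1 3)%N (sw12 2 3 1)%N (sw01 2 1 3)%N; ring.
apply: red (comb 1%N 4%N 2%N 5%N 3%N 1 (- 1) 1 (- 1)) => t.
by rewrite w12 w15 w24 w45 (sw12 4 5 3)%N (sw01 4 3 5)%N (sw01 2 4 3)%N; ring.
Qed.

End Planes.

Theorem proposition3p8 (k : closedFieldType) (l n : nat)
    (hl : (2 <= l)%N) (hln : (l <= n - 2)%N) (hn : (5 <= n)%N) :
  ~ satisfies_N (plucker_grassmannian k l n) 3.
Proof.
(* At [i = 2] property N_3 bounds the degrees of Tor_2 by 4, which forces its part of degree 5 to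
   vanish. *)
case: n hln hn => // n hln hn [_ /(_ 2 isT)[F tor]].
have {}tor : tor_homology_eq0 F 2 5%:Z by exact: tor.
case: l hl hln F tor => [|[|[|l]]] // _ hln F tor.
  exact: (plucker_lines_tor2 hn tor).
(* The bound l <= n - 2 is what lets the five letters and R fit among the columns. *)
by apply: plucker_planes_tor2 tor; move: hln; lia.
Qed.
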